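(* Let $\{(Z_n,\rho_n)\}_{n\ge 1}$ be a sequence of antipodal spaces which converges to an antipodal space $(Z,\rho_0)$ in the sense of almost-isometric convergence. Then the pointed Moebius spaces $(\mathcal{M}(Z_n,\rho_n),\rho_n)$ converge to the pointed Moebius space $(\mathcal{M}(Z,\rho_0),\rho_0)$ in the pointed Gromov-Hausdorff sense. In particular, if $(X_n,x_n)$, $n\ge 1$, and $(X,x)$ are pointed maximal Gromov product spaces such that $(\partial_P X_n,\rho_{x_n})\to(\partial_P X,\rho_x)$ in the sense of almost-isometric convergence, then $(X_n,x_n)\to(X,x)$ in the pointed Gromov-Hausdorff sense.
   Context: **Semi-metric and antipodal spaces.** A compact semi-metric space $(Z,\rho)$ is a compact metrizable space $Z$ with at least four points together with a separating function, i.e. a continuous symmetric function $\rho:Z\times Z\to[0,\infty)$ with $\rho(\xi,\eta)=0$ iff $\xi=\eta$. It is an antipodal space ($\rho$ is an antipodal function) if moreover $\sup_{\xi,\eta}\rho(\xi,\eta)=1$ and for every $\xi\in Z$ there is $\eta\in Z$ with $\rho(\xi,\eta)=1$. The cross-ratio of a separating function is $[\xi,\xi',\eta,\eta']_\rho=\frac{\rho(\xi,\eta)\rho(\xi',\eta')}{\rho(\xi,\eta')\rho(\xi',\eta)}$ for distinct points. Two separating functions on $Z$ are Moebius equivalent if they have the same cross-ratios; a Moebius homeomorphism between semi-metric spaces is a homeomorphism preserving cross-ratios. **Moebius space.** If $\rho_1,\rho_2$ are Moebius equivalent separating functions on $Z$, there is a unique positive continuous function $\frac{d\rho_2}{d\rho_1}$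 on $Z$ with $\rho_2(\xi,\eta)^2=\frac{d\rho_2}{d\rho_1}(\xi)\frac{d\rho_2}{d\rho_1}(\eta)\rho_1(\xi,\eta)^2$ for all $\xi,\eta\in Z$. For an antipodal space $(Z,\rho_0)$, the Moebius space $\mathcal{M}(Z,\rho_0)$ is the set of all antipodal functions on $Z$ Moebius equivalent to $\rho_0$, with metric $d(\rho_1,\rho_2)=\|\log\frac{d\rho_2}{d\rho_1}\|_\infty$. It is a proper geodesic metric space. **Almost-isometric (AI) convergence.** For $\epsilon>0$, an $\epsilon$-isometry $f:(Z_1,\rho_1)\to(Z_2,\rho_2)$ between compact semi-metric spaces is a (not necessarily continuous) map with $\sup_{\xi,\eta\in Z_1}|\rho_2(f(\xi),f(\eta))-\rho_1(\xi,\eta)|<\epsilon$ and such that every point $\eta\in Z_2$ satisfies $\rho_2(f(\zeta),\eta)<\epsilon$ for some $\zeta\in Z_1$. Let $d_{AI}((Z_1,\rho_1),(Z_2,\rho_2))$ be the infimum of $\epsilon>0$ for which there are $\epsilon$-isometries $Z_1\to Z_2$ and $Z_2\to Z_1$. AI-convergence $(Z_n,\rho_n)\to(Z,\rho_0)$ means $d_{AI}((Z_n,\rho_n),(Z,\rho_0))\to0$. **Pointed Gromov-Hausdorff convergence.** A map $f:X\to Y$ of metric spaces (not necessarily continuous) is an $\epsilon$-isometry if $\sup_{x_1,x_2}|d_Y(f(x_1),f(x_2))-d_X(x_1,x_2)|<\epsilon$ and $Y=\bigcup_{x\in X}B_Y(f(x),\epsilon)$. For pointed proper geodesic metric spaces,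 $(X_n,p_n)\to(X,p)$ means: for every $R>0$ and $\epsilon>0$ there is $n_0$ such that for all $n\ge n_0$ there is an $\epsilon$-isometry $f:B_{X_n}(p_n,R)\to B_X(p,R)$ with $f(p_n)=p$. Balls $B_X(p,R)$ are closed. **Gromov product spaces.** In a metric space $X$, $(y|z)_x=\frac12(d(y,x)+d(z,x)-d(y,z))$. A Gromov product space is a proper, geodesic, geodesically complete (every geodesic segment extends to a bi-infinite geodesic) metric space $X$ having a second countable Hausdorff compactification $\hat X$ such that for every $x\in X$ the Gromov product $(\cdot|\cdot)_x$ extends to a continuous function $\hat X\times\hat X\to[0,+\infty]$ and, for $\xi,\eta\in\hat X\setminus X$, $(\xi|\eta)_x=+\infty$ iff $\xi=\eta$. The compactification $\hat X$ is unique up to equivalence; the Gromov product boundary is $\partial_P X=\hat X\setminus X$. For $x\in X$, $\rho_x=\exp(-(\cdot|\cdot)_x)$ on $\partial_P X$; $(\partial_P X,\rho_x)$ is an antipodal space (boundaries are understood to have at least four points), and different $x$ give Moebius equivalent functions. $X$ is a maximal Gromov product space if for every Gromov product space $Y$ and every Moebius homeomorphism $g:\partial_P Y\to\partial_P X$, $g$ extends to an isometric embedding $Y\to X$. *)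

(* Defs.v *)
From HB Require Import structures.
From mathcomp Require Import all_boot all_order all_algebra.
From mathcomp Require Import all_classical all_reals all_analysis.
From mathcomp Require Import ring lra.

Set Implicit Arguments.
Unset Strict Implicit.
Unset Printing Implicit Defensive.

Import Order.TTheory GRing.Theory Num.Theory.
Import numFieldNormedType.Exports.

Local Open Scope classical_set_scope.
Local Open Scope ring_scope.

Definition homeomorphism (S T : topologicalType) (f : S -> T) : Prop :=
  exists g : T -> S,
    [/\ cancel f g, cancel g f, continuous f & continuous g].

Definition metrizable (R : realType) (Z : topologicalType) : Prop :=
  exists (M : metricType R) (f : Z -> M), homeomorphism f.

Section SemiMetric.
Context {R : realType}.

Definition separating (Z : topologicalType) (rho : Z -> Z -> R) : Prop :=
  [/\ continuous (fun p : Z * Z => rho p.1 p.2),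
      forall x y, rho x y = rho y x,
      forall x y, 0 <= rho x y &
      forall x y, rho x y = 0 <-> x = y].

Definition antipodal (Z : topologicalType) (rho : Z -> Z -> R) : Prop :=
  [/\ separating rho,
      sup (range (fun p : Z * Z => rho p.1 p.2)) = 1 &
      forall x, exists y, rho x y = 1].

Definition at_least_four_points (Z : topologicalType) : Prop :=
  exists2 s : seq Z, uniq s & size s = 4%N.

Definition cross_ratio (Z : Type) (rho : Z -> Z -> R) (x x' y y' : Z) : R :=
  (rho x y * rho x' y') / (rho x y' * rho x' y).

Definition moebius_equivalent (Z : topologicalType) (rho1 rho2 : Z -> Z -> R) :
    Prop :=
  forall x x' y y' : Z, uniq [:: x; x'; y; y'] ->
    cross_ratio rho1 x x' y y' = cross_ratio rho2 x x' y y'.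

Definition moebius_homeomorphism (Y Z : topologicalType)
    (rhoY : Y -> Y -> R) (rhoZ : Z -> Z -> R) (g : Y -> Z) : Prop :=
  homeomorphism g /\
  forall x x' y y' : Y, uniq [:: x; x'; y; y'] ->
    cross_ratio rhoZ (g x) (g x') (g y) (g y') = cross_ratio rhoY x x' y y'.

Definition is_moebius_derivative (Z : topologicalType)
    (rho1 rho2 : Z -> Z -> R) (f : Z -> R) : Prop :=
  [/\ continuous f, forall x, 0 < f x &
      forall x y, rho2 x y ^+ 2 = f x * f y * rho1 x y ^+ 2].

(* [moebius_derivative rho1 rho2] is d rho2 / d rho1; the default value 1 is
   irrelevant by [moebius_derivativeP] below. *)
Definition moebius_derivative (Z : topologicalType) (rho1 rho2 : Z -> Z -> R) :
    Z -> R :=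
  xget (fun=> 1) (is_moebius_derivative rho1 rho2).

Definition moebius_dist (Z : topologicalType) (rho1 rho2 : Z -> Z -> R) : R :=
  sup (range (fun x => `|ln (moebius_derivative rho1 rho2 x)|)).

End SemiMetric.

Section AlmostIsometric.
Context {R : realType}.

Definition AI_isometry (Y Z : Type) (rhoY : Y -> Y -> R) (rhoZ : Z -> Z -> R)
    (e : R) (f : Y -> Z) : Prop :=
  (ereal_sup (range (fun p : Y * Y =>
     `|rhoZ (f p.1) (f p.2) - rhoY p.1 p.2|%:E)) < e%:E)%E /\
  forall z, exists y, rhoZ (f y) z < e.

Definition AI_dist (Y Z : Type) (rhoY : Y -> Y -> R) (rhoZ : Z -> Z -> R) :
    \bar R :=
  ereal_inf [set e%:E | e in [set e : R | 0 < e /\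
    (exists f : Y -> Z, AI_isometry rhoY rhoZ e f) /\
    (exists f : Z -> Y, AI_isometry rhoZ rhoY e f)]].

Definition AI_converges (Z_ : nat -> Type) (rho_ : forall n, Z_ n -> Z_ n -> R)
    (Z : Type) (rho : Z -> Z -> R) : Prop :=
  AI_dist (rho_ n) rho @[n --> \oo] --> 0%E.

End AlmostIsometric.

Section PointedGH.
Context {R : realType}.

(* The library's [closed_ball] is the closure of the open ball, which may be
   smaller. *)
Definition cball (X : metricType R) (x : X) (r : R) : set X :=
  [set y | mdist x y <= r].

(* [f] is an [e]-isometry from [A] to [B], both with the induced metric; the
   values of [f] outside [A] are irrelevant. *)
Definition eps_isometry (X Y : metricType R) (A : set X) (B : set Y)
    (e : R) (f : X -> Y) : Prop :=
  [/\ set_fun A B f,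
      (ereal_sup [set `|mdist (f p.1) (f p.2) - mdist p.1 p.2|%:E
                 | p in A `*` A] < e%:E)%E &
      B `<=` \bigcup_(x in A) cball (f x) e].

Definition pGH_converges (X_ : nat -> metricType R) (p_ : forall n, X_ n)
    (X : metricType R) (p : X) : Prop :=
  forall r e : R, 0 < r -> 0 < e ->
  exists n0 : nat, forall n : nat, (n0 <= n)%N ->
  exists f : X_ n -> X,
    eps_isometry (cball (p_ n) r) (cball p r) e f /\ f (p_ n) = p.

End PointedGH.

Record antipodalSpace (R : realType) := AntipodalSpace {
  antipodal_sort :> topologicalType;
  antipodal_fun : antipodal_sort -> antipodal_sort -> R;
  antipodal_compact : compact [set: antipodal_sort];
  antipodal_metrizable : metrizable R antipodal_sort;
  antipodal_four_points : at_least_four_points antipodal_sort;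
  antipodal_funP : antipodal antipodal_fun }.

Record moebiusSpace (R : realType) (Z : antipodalSpace R) := MoebiusSpace {
  moebius_fun :> Z -> Z -> R;
  moebius_antipodal : antipodal moebius_fun;
  moebius_equiv : moebius_equivalent (@antipodal_fun R Z) moebius_fun }.

Definition moebius_base (R : realType) (Z : antipodalSpace R) : moebiusSpace Z :=
  MoebiusSpace (antipodal_funP Z) (fun x x' y y' _ => erefl).

Section MoebiusDerivative.
Context {R : realType} {Z : topologicalType}.
Hypothesis Z4 : at_least_four_points Z.
Implicit Types rho : Z -> Z -> R.

Lemma fresh_point (s : seq Z) : (size s < 4)%N -> exists z, z \notin s.
Proof.
move=> s4; apply/not_existsP => H; case: Z4 => t ut t4.
have /(uniq_leq_size ut) : {subset t <= s}.
  by move=> z _; apply/negPn/negP/H.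
by rewrite t4 leqNgt s4.
Qed.

Lemma separating_gt0 rho x y : separating rho -> x != y -> 0 < rho x y.
Proof.
move=> [_ _ ge0 eq0] xy; rewrite lt_neqAle ge0 andbT eq_sym.
by apply: contra xy => /eqP/eq0/eqP.
Qed.

Lemma moebius_derivative_unique rho1 rho2 (f g : Z -> R) :
  separating rho1 ->
  is_moebius_derivative rho1 rho2 f -> is_moebius_derivative rho1 rho2 g ->
  f = g.
Proof.
move=> s1 [_ f0 fE] [_ g0 gE]; apply/funext => x.
have [y] := @fresh_point [:: x] isT; rewrite inE => yx.
have [z] := @fresh_point [:: x; y] isT; rewrite !inE negb_or => /andP[zx zy].
have e a b : a != b -> f a * f b = g a * g b.
  move=> ab; have := fE a b; rewrite gE => /mulIf -> //.
  by rewrite sqrf_eq0 gt_eqF// separating_gt0.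
have exy := e _ _ yx; have exz := e _ _ zx; have eyz := e _ _ zy.
have fy := f0 y; have fz := f0 z; have gy := g0 y; have gz := g0 z.
have fx := f0 x; have gx := g0 x.
have : f x ^+ 2 = g x ^+ 2.
  apply: (@mulIf _ (f z * f y)); first by rewrite mulf_neq0// gt_eqF.
  rewrite [in RHS]eyz.
  transitivity ((f y * f x) * (f z * f x)); first by ring.
  by rewrite exy exz; ring.
by move/eqP; rewrite eqrXn2 ?ltW// => /eqP.
Qed.

Section Existence.
Variables rho1 rho2 : Z -> Z -> R.
Hypotheses (s1 : separating rho1) (s2 : separating rho2).
Hypothesis e12 : moebius_equivalent rho1 rho2.

Let r x y := rho2 x y / rho1 x y.
Let L x a b := r x a * r x b / r a b.

Let rC x y : r x y = r y x.
Proof. by case: s1 s2 => [_ c1 _ _] [_ c2 _ _]; rewrite /r c1 c2. Qed.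

Let r_gt0 x y : x != y -> 0 < r x y.
Proof. by move=> xy; rewrite divr_gt0// separating_gt0. Qed.

Let r_cross x y a b : uniq [:: x; y; a; b] -> r x a * r y b = r x b * r y a.
Proof.
move=> u; have := e12 u; move: u; rewrite /= !inE !negb_or /cross_ratio /r.
move=> /andP[/and3P[xy xa xb] /andP[/andP[ya yb] _]].
have n1 c d : c != d -> rho1 c d != 0 by move=> ?; rewrite gt_eqF// separating_gt0.
have n2 c d : c != d -> rho2 c d != 0 by move=> ?; rewrite gt_eqF// separating_gt0.
move: (n1 _ _ xa) (n1 _ _ xb) (n1 _ _ ya) (n1 _ _ yb).
move: (n2 _ _ xa) (n2 _ _ xb) (n2 _ _ ya) (n2 _ _ yb) => h1 h2 h3 h4 h5 h6 h7 h8.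
move=> /eqP; rewrite eqr_div ?mulf_neq0// => /eqP E.
apply/eqP; rewrite !mulf_div eqr_div ?mulf_neq0//; apply/eqP.
by rewrite -E mulrC.
Qed.

Let LC x a b : L x a b = L x b a.
Proof. by rewrite /L (rC a b) [r x a * _]mulrC. Qed.

Let L_step x a b c : x != a -> x != b -> x != c -> a != b -> a != c ->
  L x a b = L x a c.
Proof.
move=> xa xb xc ab ac; have [->//|bc] := eqVneq b c.
have n1 : r a b != 0 by rewrite gt_eqF// r_gt0.
have n2 : r a c != 0 by rewrite gt_eqF// r_gt0.
apply/eqP; rewrite eqr_div//; apply/eqP.
have := @r_cross x a b c; rewrite /= !inE !negb_or xa xb xc ab ac bc.
by move=> /(_ isT) E; rewrite -[LHS]mulrA E mulrA.
Qed.

Let L_indep x a b c d : x != a -> x != b -> x != c -> x != d ->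
  a != b -> c != d -> L x a b = L x c d.
Proof.
move=> xa xb xc xd ab cd; have [ad|ad] := eqVneq a d.
  by subst d; rewrite (LC x c a); apply: L_step => //; rewrite eq_sym.
rewrite (@L_step _ _ _ d)// (LC x a d) (LC x c d).
by apply: L_step => //; rewrite eq_sym.
Qed.

Let pair_ex x : exists p : Z * Z, [/\ x != p.1, x != p.2 & p.1 != p.2].
Proof.
have [y] := @fresh_point [:: x] isT; rewrite inE => yx.
have [z] := @fresh_point [:: x; y] isT; rewrite !inE negb_or => /andP[zx zy].
by exists (y, z); split => //=; rewrite eq_sym.
Qed.

Let l x := let p := sval (cid (pair_ex x)) in L x p.1 p.2.

Let lE x a b : x != a -> x != b -> a != b -> l x = L x a b.
Proof. by rewrite /l; case: cid => -[c d] /= [xc xd cd] xa xb ab; exact: L_indep. Qed.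

Let cvg_rho rho x a : separating rho -> rho y a @[y --> x] --> rho x a.
Proof.
move=> [c _ _ _].
apply: (@cvg_comp _ _ _ (fun y => (y, a)) (fun p => rho p.1 p.2) _ (nbhs (x, a))).
  by apply: cvg_pair => //; exact: cvg_cst.
exact: (c (x, a)).
Qed.

Let l_continuous : continuous l.
Proof.
move=> x; have [[a b] /= [xa xb ab]] := pair_ex x.
have far c : x != c -> \forall y \near x, y != c.
  move=> xc; have := cvgr_neq0 _ (@cvg_rho rho1 x c s1).
  rewrite gt_eqF ?separating_gt0// => /(_ _ isT); apply: filterS => y.
  by apply: contra => /eqP ->; apply/eqP; case: s1 => _ _ _ /(_ c c) [_ ->].
rewrite /continuous_at (lE xa xb ab).
apply: cvg_trans (_ : L y a b @[y --> x] --> _); last first.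
  have cr c : x != c -> r y c @[y --> x] --> r x c.
    move=> xc; apply: cvgM; first exact: cvg_rho.
    by apply: cvgV; [rewrite gt_eqF// separating_gt0 | exact: cvg_rho].
  by apply: cvgM; [apply: cvgM; exact: cr | exact: cvg_cst].
apply: near_eq_cvg; near=> y; rewrite (lE _ _ ab)//; near: y; exact: far.
Unshelve. all: by end_near. Qed.

Lemma moebius_derivative_exists :
  is_moebius_derivative rho1 rho2 (moebius_derivative rho1 rho2).
Proof.
apply: xgetPex; exists l; split; first exact: l_continuous.
  move=> x; have [[a b] /= [xa xb ab]] := pair_ex x.
  rewrite (lE xa xb ab).
  by apply: divr_gt0; [apply: mulr_gt0; exact: r_gt0|exact: r_gt0].
move=> x y; have [<-|xy] := eqVneq x y.
  case: s1 s2 => [_ _ _ /(_ x x) [_ z1]] [_ _ _ /(_ x x) [_ z2]].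
  by rewrite z1// z2// expr0n/= mulr0.
have [z] := @fresh_point [:: x; y] isT; rewrite !inE negb_or => /andP[zx zy].
have [xz yz yx] : [/\ x != z, y != z & y != x] by split; rewrite eq_sym.
rewrite (lE xy xz yz) (lE yx yz xz) /L (rC y x).
have rxz := r_gt0 xz; have ryz := r_gt0 yz.
transitivity (r x y ^+ 2 * rho1 x y ^+ 2).
  by rewrite -exprMn /r mulfVK// gt_eqF// separating_gt0.
by congr (_ * _); field; rewrite !gt_eqF.
Qed.

End Existence.

Lemma moebius_derivativeP rho1 rho2 (f : Z -> R) :
  separating rho1 -> separating rho2 -> moebius_equivalent rho1 rho2 ->
  is_moebius_derivative rho1 rho2 f <-> f = moebius_derivative rho1 rho2.
Proof.
move=> s1 s2 e12; have D := moebius_derivative_exists s1 s2 e12.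
by split=> [|->//] fD; exact: moebius_derivative_unique fD D.
Qed.

End MoebiusDerivative.

Section MoebiusMetric.
Context {R : realType} (Z : antipodalSpace R).
Implicit Types rho : moebiusSpace Z.

Let D rho1 rho2 : Z -> R := moebius_derivative rho1 rho2.

Let moebius_separating rho : separating rho.
Proof. by case: (moebius_antipodal rho). Qed.

Let DP rho1 rho2 : is_moebius_derivative rho1 rho2 (D rho1 rho2).
Proof.
apply: moebius_derivative_exists => //; first exact: antipodal_four_points.
by move=> x x' y y' u; rewrite -!moebius_equiv.
Qed.

Let D_unique rho1 rho2 (f : Z -> R) :
  is_moebius_derivative rho1 rho2 f -> D rho1 rho2 = f.
Proof.
move=> fP; apply: (moebius_derivative_unique _ _ (DP rho1 rho2) fP) => //.
exact: antipodal_four_points.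
Qed.

Let point_ex : exists x : Z, True.
Proof.
by have [x _] := @fresh_point Z (antipodal_four_points Z) [::] isT; exists x.
Qed.

Let has_sup_dist rho1 rho2 :
  has_sup (range (fun x : Z => `|ln (D rho1 rho2 x)|)).
Proof.
have [x0 _] := point_ex; apply: compact_has_sup.
  by exists `|ln (D rho1 rho2 x0)|, x0.
apply: continuous_compact; last exact: antipodal_compact.
apply: continuous_subspaceT => x; have [c p _] := DP rho1 rho2.
apply: cvg_norm; apply: continuous_cvg; last exact: c.
exact: continuous_ln.
Qed.

Let le_dist rho1 rho2 x : `|ln (D rho1 rho2 x)| <= moebius_dist rho1 rho2.
Proof. by apply: ub_le_sup; [case: (has_sup_dist rho1 rho2)|exists x]. Qed.

Let dist_le rho1 rho2 (c : R) :
  (forall x, `|ln (D rho1 rho2 x)| <= c) -> moebius_dist rho1 rho2 <= c.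
Proof.
move=> h; apply: ge_sup; first by case: (has_sup_dist rho1 rho2).
by move=> _ [x _ <-]; exact: h.
Qed.

Let moebius_distxx rho : moebius_dist rho rho = 0.
Proof.
have D1 : D rho rho = fun=> 1.
  by apply: D_unique; split=> [x|x|x y]; [exact: cvg_cst|exact: ltr01|rewrite !mul1r].
apply/eqP; rewrite eq_le; apply/andP; split.
  by apply: dist_le => x; rewrite D1 ln1 normr0.
by have [x _] := point_ex; apply: le_trans (le_dist _ _ x).
Qed.

Let moebius_dist_positivity rho1 rho2 : moebius_dist rho1 rho2 = 0 -> rho1 = rho2.
Proof.
move=> d0; have [_ p E] := DP rho1 rho2.
have D1 x : D rho1 rho2 x = 1.
  by apply/eqP; rewrite -ln_eq0// -normr_le0 -d0 le_dist.
have e : rho1 = rho2 :> (Z -> Z -> R).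
  apply/funext => x; apply/funext => y; have := E x y.
  rewrite !D1 !mul1r => /eqP; rewrite eqrXn2//.
  - by move=> /eqP.
  - by case: (moebius_separating rho2).
  - by case: (moebius_separating rho1).
case: rho1 rho2 e {d0 p E D1} => [f a m] [g b n] /= e; subst g.
by congr MoebiusSpace; exact: Prop_irrelevance.
Qed.

Let moebius_dist_sym rho1 rho2 : moebius_dist rho1 rho2 = moebius_dist rho2 rho1.
Proof.
have [c p E] := DP rho1 rho2.
have DV : D rho2 rho1 = fun x => (D rho1 rho2 x)^-1.
  apply: D_unique; split=> [x|x|x y].
  - by apply: cvgV; [rewrite gt_eqF|exact: c].
  - by rewrite invr_gt0.
  - by rewrite E; field; rewrite !gt_eqF.
have lnD x : `|ln (D rho2 rho1 x)| = `|ln (D rho1 rho2 x)|.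
  by rewrite DV lnV ?posrE// normrN.
by apply/eqP; rewrite eq_le !dist_le// => x; [rewrite lnD|rewrite -lnD]; exact: le_dist.
Qed.

Let moebius_dist_triangle rho2 rho1 rho3 :
  moebius_dist rho1 rho3 <= moebius_dist rho1 rho2 + moebius_dist rho2 rho3.
Proof.
have [c p E] := DP rho1 rho2; have [c' p' E'] := DP rho2 rho3.
have DM : D rho1 rho3 = fun x => D rho1 rho2 x * D rho2 rho3 x.
  apply: D_unique; split=> [x|x|x y].
  - by apply: cvgM; [exact: c|exact: c'].
  - by rewrite mulr_gt0.
  - by rewrite E' E; ring.
apply: dist_le => x; rewrite DM lnM ?posrE//.
by rewrite (le_trans (ler_normD _ _))// lerD// le_dist.
Qed.

HB.instance Definition _ := gen_eqMixin (moebiusSpace Z).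
HB.instance Definition _ := gen_choiceMixin (moebiusSpace Z).
HB.instance Definition _ := isMetric.Build R (moebiusSpace Z)
  moebius_distxx moebius_dist_positivity moebius_dist_sym moebius_dist_triangle.

Lemma moebius_mdistE rho1 rho2 : mdist rho1 rho2 = moebius_dist rho1 rho2.
Proof. by []. Qed.

End MoebiusMetric.

Section Geodesics.
Context {R : realType} (X : metricType R).

Definition proper_metric : Prop :=
  forall (x : X) (r : R), compact (cball x r).

Definition isometric_on (A : set R) (c : R -> X) : Prop :=
  forall s t, A s -> A t -> mdist (c s) (c t) = `|s - t|.

Definition geodesic_metric : Prop :=
  forall x y : X, exists c : R -> X,
    [/\ c 0 = x, c (mdist x y) = y & isometric_on `[0, mdist x y] c].

Definition geodesically_complete : Prop :=
  forall (a b : R) (c : R -> X), a <= b -> isometric_on `[a, b] c ->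
  exists c' : R -> X, isometric_on setT c' /\ {in `[a, b], c =1 c'}.

Definition gromov_product (x y z : X) : R :=
  (mdist y x + mdist z x - mdist y z) / 2.

End Geodesics.

(* [iota] embeds [X] as a dense subspace of the compact Hausdorff space
   [hatX]. *)
Definition compactification (X hatX : topologicalType) (iota : X -> hatX) : Prop :=
  [/\ compact [set: hatX], hausdorff_space hatX, injective iota,
      forall A : set X, open A <-> exists2 U, open U & iota @^-1` U = A &
      dense (range iota)].

(* The compactification is carried as data; it is unique up to equivalence.
   By density of [X], [gp_ext] is then determined by [gp_extE] and
   [gp_ext_continuous]. *)
Record gromovProductSpace (R : realType) := GromovProductSpace {
  gp_sort :> metricType R;
  gp_hat : topologicalType;
  gp_iota : gp_sort -> gp_hat;
  gp_ext : gp_sort -> gp_hat -> gp_hat -> \bar R;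
  gp_proper : proper_metric gp_sort;
  gp_geodesic : geodesic_metric gp_sort;
  gp_complete : geodesically_complete gp_sort;
  gp_compactification : compactification gp_iota;
  gp_second_countable : @second_countable gp_hat;
  gp_ext_ge0 : forall x p q, (0 <= gp_ext x p q)%E;
  gp_ext_continuous : forall x,
    continuous (fun p : gp_hat * gp_hat => gp_ext x p.1 p.2);
  gp_extE : forall x y z,
    gp_ext x (gp_iota y) (gp_iota z) = (gromov_product x y z)%:E;
  gp_ext_boundary : forall x p q, ~ range gp_iota p -> ~ range gp_iota q ->
    gp_ext x p q = +oo%E <-> p = q;
  gp_four_points : at_least_four_points (set_type (~` range gp_iota)) }.

Section GromovProductBoundary.
Context {R : realType}.

Definition gp_boundary (X : gromovProductSpace R) : topologicalType :=
  set_type (~` range (@gp_iota R X)).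

(* [expeR (- +oo) = 0], and the argument of [fine] is always finite. *)
Definition visual (X : gromovProductSpace R) (x : X)
    (p q : gp_boundary X) : R :=
  fine (expeR (- gp_ext x (set_val p) (set_val q))%E).

Definition extends_to_isometric_embedding (Y X : gromovProductSpace R)
    (g : gp_boundary Y -> gp_boundary X) : Prop :=
  exists (f : Y -> X) (h : gp_hat Y -> gp_hat X),
    [/\ forall y y', mdist (f y) (f y') = mdist y y',
        continuous h,
        forall y, h (gp_iota y) = gp_iota (f y) &
        forall p : gp_boundary Y, h (set_val p) = set_val (g p)].

Definition maximal_gromov_product_space (X : gromovProductSpace R) : Prop :=
  forall (Y : gromovProductSpace R) (y : Y) (x : X)
    (g : gp_boundary Y -> gp_boundary X),
    moebius_homeomorphism (@visual Y y) (@visual X x) g ->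
    extends_to_isometric_embedding g.

End GromovProductBoundary.

(* Main.v *)
Require Import Defs.
From HB Require Import structures.
From mathcomp Require Import all_boot all_order all_algebra.
From mathcomp Require Import all_classical all_reals all_analysis.
From mathcomp Require Import ring lra.

Set Implicit Arguments.
Unset Strict Implicit.
Unset Printing Implicit Defensive.

Import Order.TTheory GRing.Theory Num.Theory.
Import numFieldNormedType.Exports.

Local Open Scope classical_set_scope.
Local Open Scope ring_scope.

(** A function on [Z] in the Moebius class of [rho] has the form
    [rho x y * exp (- h x - h y)], and it is antipodal exactly when
    [rho x y <= exp (h x + h y)] for all [x] and [y], with equality for some [y]
    whatever [x] is. Such potentials [h] are the points of the tight span, or
    injective hull, of the kernel [ln rho], and the distance of the Moebius space is
    twice the uniform distance between potentials ([mdist_attained]). Everything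
    rests on the canonical retraction onto the tight span ([retract]). It sends every
    bounded function satisfying the inequality to a potential, is 1-Lipschitz
    ([retract_close]), and moves a function by at most its distance to its conjugate
    ([conjugate_le_retract]). It needs no continuity of its argument, because
    potentials are automatically continuous.

    Convergence. Closeness in the almost-isometric sense gives correspondences between
    [Z_ n] and [Z] of small distortion. A potential pulled back along a correspondence
    satisfies the inequality up to a small constant, since on a ball only values of
    [rho] that are bounded below matter. Adding the constant and retracting defines a
    map between balls of the Moebius spaces ([transfer]); it is 1-Lipschitz, fixes the
    base point, stays near the pulled back function ([transfer_near]), and the map in
    the other direction is nearly its inverse ([transfer_surj]).

    Maximal spaces. It suffices that a maximal Gromov product space [X] is isometric
    to the Moebius space of its boundary through [y |-> visual y]. This map is an
    isometric embedding because geodesics extend to the boundary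
    ([moebius_dist_visual]). For surjectivity, maximality is applied to the Moebius
    space itself, once it is known to be a Gromov product space with the same boundary
    ([moebius_gp]): the extension of the identity of the boundary is then a section of
    the embedding ([visual_point_surj]).

    That the Moebius space is a Gromov product space also comes from the retraction.
    Retracting affine segments gives geodesics, and retracting a potential lowered at
    one point [xi] and raised elsewhere gives rays to [xi]. The compactification
    embeds in the functions on [Z], a potential [h] with uniform norm [N] being sent
    to [exp (h - N)] and a point [x] of [Z] to [rho x]. For two points of this
    compactification, [exp (- (p | q))] is a supremum that makes sense everywhere and
    is Lipschitz for the uniform distance ([hat_pair_lipschitz]). Compactness holds
    because potentials of bounded size are equicontinuous, while a potential of large
    norm is nearly a function [rho x] ([hat_near_ideal]). *)

(** * The tight span of an antipodal kernel *)

Section TightSpan.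
Context {R : realType} {Z : Type} (rho : Z -> Z -> R).
Implicit Types (h k : Z -> R) (M c : R).

Definition antipodal_kernel : Prop :=
  [/\ forall x y, rho x y = rho y x, forall x y, 0 <= rho x y <= 1 &
      forall x, exists y, rho x y = 1].

Definition bounded_by M h : Prop := forall x, `|h x| <= M.

Definition sup_close c h k : Prop := forall x, `|h x - k x| <= c.

Definition feasible h : Prop := forall x y, rho x y <= expR (h x + h y).

(** For bounded [h] this is, by [conjugate_leP], the least function [g] such that
    [rho x y <= exp (g x + h y)]. *)
Definition conjugate h : Z -> R :=
  fun x => ln (sup (range (fun y => rho x y * expR (- h y)))).

(** The points of the tight span of [ln rho]. Boundedness is the only regularity
    required: it entails continuity when [rho] is continuous on a compact space. *)
Definition tight h : Prop :=
  (exists M, bounded_by M h) /\ forall x, conjugate h x = h x.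

Definition average h : Z -> R := fun x => (h x + conjugate h x) / 2.

(** On a feasible [h] the iterates of [average] decrease, so that this infimum is
    their limit. *)
Definition retract h : Z -> R :=
  fun x => inf (range (fun n => iter n average h x)).

Hypothesis rhoP : antipodal_kernel.

Let rhoC x y : rho x y = rho y x. Proof. by case: rhoP. Qed.
Let rho_ge0 x y : 0 <= rho x y.
Proof. by case: rhoP => _ /(_ x y)/andP[]. Qed.
Let rho_le1 x y : rho x y <= 1.
Proof. by case: rhoP => _ /(_ x y)/andP[]. Qed.
Let antipode x : exists y, rho x y = 1. Proof. by case: rhoP. Qed.

Lemma bounded_byW M M' h : M <= M' -> bounded_by M h -> bounded_by M' h.
Proof. by move=> MM hM x; exact: le_trans (hM x) MM. Qed.

Lemma sup_close_sym c h k : sup_close c h k -> sup_close c k h.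
Proof. by move=> hk x; rewrite distrC. Qed.

Let has_sup_conj M h x : bounded_by M h ->
  has_sup (range (fun y => rho x y * expR (- h y))).
Proof.
move=> hM; split; first by exists (rho x x * expR (- h x)), x.
exists (expR M) => _ [y _ <-]; apply: le_trans (_ : 1 * expR (- h y) <= _).
  by rewrite ler_wpM2r// expR_ge0.
rewrite mul1r ler_expR; have := hM y; rewrite ler_norml => /andP[? _]; lra.
Qed.

(** The antipode of [x] makes the supremum positive, so its logarithm is genuine. *)
Lemma conjugate_leP M h x c : bounded_by M h ->
  conjugate h x <= c <-> forall y, rho x y <= expR (c + h y).
Proof.
move=> hM; have hs := has_sup_conj x hM; have [z xz] := antipode x.
have s0 : 0 < sup (range (fun y => rho x y * expR (- h y))).
  apply: lt_le_trans (_ : rho x z * expR (- h z) <= _).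
    by rewrite xz mul1r expR_gt0.
  by apply: ub_le_sup; [case: hs|exists z].
have E y : (rho x y <= expR (c + h y)) = (rho x y * expR (- h y) <= expR c).
  by rewrite expRD expRN ler_pdivrMr// expR_gt0.
rewrite /conjugate -ler_expR lnK//; split => [le y|le].
  by rewrite E; apply: le_trans le; apply: ub_le_sup; [case: hs|exists y].
by apply: ge_sup; [case: hs|move=> _ [y _ <-]; rewrite -E].
Qed.

Lemma conjugateP M h x y : bounded_by M h ->
  rho x y <= expR (conjugate h x + h y).
Proof. by move=> hM; apply: (conjugate_leP x _ hM).1. Qed.

Lemma conjugate_le M h : bounded_by M h -> feasible h ->
  forall x, conjugate h x <= h x.
Proof. by move=> hM hf x; apply/(conjugate_leP _ _ hM) => y. Qed.

Lemma conjugate_shift M h k c : bounded_by M h -> bounded_by M k ->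
  (forall x, h x <= k x + c) -> forall x, conjugate k x <= conjugate h x + c.
Proof.
move=> hM kM hk x; apply/(conjugate_leP _ _ kM) => y.
by apply: le_trans (conjugateP x y hM) _; rewrite ler_expR; have := hk y; lra.
Qed.

Lemma conjugate_close M h k c : bounded_by M h -> bounded_by M k ->
  sup_close c h k -> sup_close c (conjugate h) (conjugate k).
Proof.
move=> hM kM hk x; rewrite ler_distl; apply/andP; split.
  rewrite lerBlDr; apply: (conjugate_shift hM kM) => y.
  by have := hk y; rewrite ler_distl => /andP[_]; lra.
apply: (conjugate_shift kM hM) => y.
by have := hk y; rewrite ler_distl => /andP[]; lra.
Qed.

Lemma conjugate0 x : conjugate (fun=> 0) x = 0.
Proof.
have b0 : bounded_by 0 (fun=> 0 : R) by move=> y; rewrite normr0.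
apply/eqP; rewrite eq_le; apply/andP; split.
  by apply/(conjugate_leP _ _ b0) => y; rewrite addr0 expR0.
have [y xy] := antipode x; have := conjugateP x y b0.
by rewrite xy addr0 -{1}(expR0 R) ler_expR.
Qed.

Lemma conjugate_bounded M h : bounded_by M h -> bounded_by M (conjugate h).
Proof.
move=> hM x; have M0 : 0 <= M := le_trans (normr_ge0 _) (hM x).
rewrite -[_ x]subr0 -(conjugate0 x); apply: (conjugate_close hM).
  by move=> y; rewrite normr0.
by move=> y; rewrite subr0.
Qed.

Lemma tight_feasible h : tight h -> feasible h.
Proof. by move=> [[M hM] hE] x y; rewrite -{1}hE; exact: conjugateP. Qed.

Lemma tight0 : tight (fun=> 0).
Proof. by split; [exists 0 => x; rewrite normr0|exact: conjugate0]. Qed.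

Lemma average_bounded M h : bounded_by M h -> bounded_by M (average h).
Proof.
move=> hM x; have := hM x; have := conjugate_bounded hM x.
rewrite !ler_norml /average => /andP[? ?] /andP[? ?]; apply/andP; split; lra.
Qed.

(** Multiplying the two inequalities [rho x y <= exp (h x + conjugate h y)] and
    [rho x y <= exp (conjugate h x + h y)] gives the square of the claim. *)
Lemma average_feasible M h : bounded_by M h -> feasible (average h).
Proof.
move=> hM x y; rewrite -ler_sqr ?nnegrE ?rho_ge0 ?expR_ge0//.
rewrite !expr2 -[leRHS]expRD.
apply: le_trans (_ : expR (conjugate h x + h y) * expR (conjugate h y + h x) <= _).
  apply: ler_pM => //; first exact: conjugateP hM.
  by rewrite rhoC; exact: conjugateP hM.
by rewrite -expRD ler_expR /average; lra.
Qed.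

Lemma average_close M h k c : bounded_by M h -> bounded_by M k ->
  sup_close c h k -> sup_close c (average h) (average k).
Proof.
move=> hM kM hk x; have := hk x; have := conjugate_close hM kM hk x.
rewrite !ler_norml /average => /andP[? ?] /andP[? ?]; apply/andP; split; lra.
Qed.

Section Retract.
Variables (M : R) (h : Z -> R).
Hypotheses (hM : bounded_by M h) (hf : feasible h).

Let H n := iter n average h.

Let HM n : bounded_by M (H n).
Proof. by elim: n => //= n; exact: average_bounded. Qed.

Let Hf n : feasible (H n).
Proof. by case: n => //= n; exact: average_feasible (HM n). Qed.

Let H_step n x : H n.+1 x <= H n x.
Proof. by rewrite /H/= /average; have := conjugate_le (HM n) (Hf n) x; rewrite /H; lra. Qed.

Let H_le n m x : (n <= m)%N -> H m x <= H n x.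
Proof.
move=> /subnKC <-; elim: (m - n)%N => [|k IH]; first by rewrite addn0.
by rewrite addnS; apply: le_trans IH; exact: H_step.
Qed.

Let conj_le n m x : (n <= m)%N -> conjugate (H n) x <= conjugate (H m) x.
Proof.
move=> nm; have := conjugate_shift (HM m) (HM n) (c := 0).
by move=> /(_ _ x); rewrite addr0; apply => y; rewrite addr0 H_le.
Qed.

(** The sequences [H n] and [conjugate (H n)] squeeze the limit, and each
    averaging step halves the gap between them. *)
Let gap n x : H n x - conjugate (H n) x <= (2 * M) / 2 ^+ n.
Proof.
elim: n x => [|n IH] x.
  have := HM 0 x; have := conjugate_bounded (HM 0) x.
  by rewrite expr0 divr1 !ler_norml => /andP[? ?] /andP[? ?]; lra.
have := conj_le x (leqnSn n); have := IH x; rewrite {2 3}/H /= -/(H n) /average.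
rewrite exprS invfM; set a := conjugate _ _; set b := conjugate _ _; lra.
Qed.

Let conj_le_H n m x : conjugate (H n) x <= H m x.
Proof.
apply: le_trans (conj_le x (leq_maxl n m)) _.
by apply: le_trans (conjugate_le (HM _) (Hf _) x) _; rewrite H_le// leq_maxr.
Qed.

Let hi x : has_inf (range (fun n => H n x)).
Proof.
by split; [exists (H 0 x), 0%N|exists (conjugate h x) => _ [n _ <-]; exact: (conj_le_H 0)].
Qed.

Let retract_le_iter n x : retract h x <= H n x.
Proof. by apply: ge_inf; [case: (hi x)|exists n]. Qed.

Let conj_le_retract n x : conjugate (H n) x <= retract h x.
Proof.
by apply: lb_le_inf; [case: (hi x)|move=> _ [m _ <-]; exact: conj_le_H].
Qed.

Lemma retract_le x : retract h x <= h x.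
Proof. exact: (retract_le_iter 0). Qed.

Lemma retract_le_average x : retract h x <= average h x.
Proof. exact: (retract_le_iter 1). Qed.

Lemma conjugate_le_retract x : conjugate h x <= retract h x.
Proof. exact: (conj_le_retract 0). Qed.

Lemma retract_bounded : bounded_by M (retract h).
Proof.
move=> x; have := retract_le x; have := conjugate_le_retract x.
have := hM x; have := conjugate_bounded hM x.
by rewrite !ler_norml => /andP[? ?] /andP[? ?] ? ?; apply/andP; split; lra.
Qed.

Let small e : 0 < e -> exists n, (2 * M) / 2 ^+ n < e.
Proof.
move=> e0; have c0 : (fun n => (2 * M) * (2^-1 : R) ^+ n) @ \oo --> 0.
  by apply: cvg_geometric; rewrite gtr0_norm ?invr_gt0// invf_lt1// ltr1n.
have := cvgr_lt _ c0 _ e0 => -[n _ /(_ n (leqnn n))] /=.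
by rewrite exprVn; exists n.
Qed.

Lemma retract_tight : tight (retract h).
Proof.
split; first by exists M; exact: retract_bounded.
have cH n x : conjugate (H n) x <= conjugate (retract h) x.
  have := conjugate_shift retract_bounded (HM n) (c := 0).
  by move=> /(_ _ x); rewrite addr0; apply => y; rewrite addr0 retract_le_iter.
move=> x; apply/eqP; rewrite eq_le; apply/andP; split.
  apply/ler_addgt0Pr => e e0; have [n ne] := small e0.
  apply/(conjugate_leP _ _ retract_bounded) => y.
  apply: le_trans (conjugateP x y (HM n)) _; rewrite ler_expR.
  have := gap n y; have := conj_le_retract n x; have := conj_le_retract n y.
  by lra.
apply/ler_addgt0Pr => e e0; have [n ne] := small e0.
by have := gap n x; have := cH n x; have := retract_le_iter n x; lra.
Qed.

End Retract.

Lemma retract_close M h k c :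
  bounded_by M h -> feasible h -> bounded_by M k -> feasible k ->
  sup_close c h k -> sup_close c (retract h) (retract k).
Proof.
have main h' k' : bounded_by M h' -> feasible h' -> bounded_by M k' ->
    feasible k' -> sup_close c h' k' -> forall x, retract h' x - c <= retract k' x.
  move=> hM hf kM kf hk x.
  have it n : [/\ bounded_by M (iter n average h'),
                  bounded_by M (iter n average k') &
                  sup_close c (iter n average h') (iter n average k')].
    elim: n => //= n [bh bk b]; split; [exact: average_bounded..|].
    exact: average_close b.
  apply: lb_le_inf; first by exists (k' x), 0%N.
  move=> _ [n _ <-]; have [_ _ /(_ x)] := it n.
  have : retract h' x <= iter n average h' x.
    apply: ge_inf; last by exists n.
    exists (- M) => _ [m _ <-]; have [/(_ x)] := it m.
    by rewrite ler_norml => /andP[].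
  by rewrite ler_norml => ? /andP[? ?]; lra.
move=> hM hf kM kf hk x; rewrite ler_distl.
have := main _ _ hM hf kM kf hk x.
have := main _ _ kM kf hM hf (sup_close_sym hk) x; lra.
Qed.

Lemma retract_id h : tight h -> retract h = h.
Proof.
move=> ht; have [[M hM] hE] := ht; have hf := tight_feasible ht.
apply/funext => x; apply/eqP; rewrite eq_le (retract_le hM hf)/= -{1}hE.
exact: conjugate_le_retract hM hf x.
Qed.

(** Nonnegative constants are moved to [0] exactly, which is what keeps base points fixed. *)
Lemma retract_cst c : 0 <= c -> retract (fun=> c) = fun=> 0.
Proof.
move=> c0; have b : bounded_by c (fun=> c : R) by move=> x; rewrite ger0_norm.
have f : feasible (fun=> c).
  by move=> x y; apply: le_trans (rho_le1 _ _) _; rewrite -expR0 ler_expR; lra.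
have [_ tE] := retract_tight b f.
have cc x : conjugate (fun=> c) x <= - c.
  by apply/(conjugate_leP _ _ b) => y; rewrite addNr expR0.
have le0 x : retract (fun=> c) x <= 0.
  by apply: le_trans (retract_le_average b f x) _; rewrite /average; have := cc x; lra.
have b0 : bounded_by c (fun=> 0 : R) by move=> x; rewrite normr0.
apply/funext => x; apply/eqP; rewrite eq_le le0/= -(conjugate0 x) -tE.
rewrite -[leRHS]addr0; apply: (conjugate_shift (retract_bounded b f) b0) => y.
by rewrite addr0.
Qed.

End TightSpan.

(** * Transfer of potentials along a correspondence *)

Section Correspondence.
Context {R : realType} {Y Z : Type}.
Variables (rhoY : Y -> Y -> R) (rhoZ : Z -> Z -> R).

Definition correspondence (C : Y -> Z -> Prop) (e : R) : Prop :=
  [/\ forall a, exists z, C a z, forall z, exists a, C a z &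
      forall a b z w, C a z -> C b w -> `|rhoY a b - rhoZ z w| <= e].

End Correspondence.

Lemma correspondence_sym {R : realType} (Y Z : Type) (rhoY : Y -> Y -> R)
    (rhoZ : Z -> Z -> R) C e :
  correspondence rhoY rhoZ C e -> correspondence rhoZ rhoY (fun z a => C a z) e.
Proof. by move=> [l r d]; split=> // *; rewrite distrC d. Qed.

(** Where [exp s] is bounded below, an additive error [e] is a multiplicative one. *)
Lemma expR_perturb {R : realType} (a b s e M : R) :
  a <= expR s -> `|a - b| <= e -> 0 <= s + 2 * M -> 0 <= e ->
  b <= expR (s + e * expR (2 * M)).
Proof.
move=> as_ ab Ms e0; rewrite expRD.
apply: le_trans (_ : expR s * (1 + e * expR (2 * M)) <= _); last first.
  by rewrite ler_wpM2l ?expR_ge0// expR_ge1Dx.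
rewrite mulrDr mulr1 mulrCA -expRD.
have : 1 <= expR (s + 2 * M) by rewrite -[leLHS]expR0 ler_expR; lra.
by move=> /(ler_wpM2l e0); move: ab; rewrite ler_distl => /andP[? ?]; lra.
Qed.

Section Transfer.
Context {R : realType} {Y Z : Type}.
Variables (rhoY : Y -> Y -> R) (rhoZ : Z -> Z -> R).
Variables (C : Y -> Z -> Prop) (e M : R).
Hypotheses (rhoYP : antipodal_kernel rhoY) (rhoZP : antipodal_kernel rhoZ).
Hypotheses (CP : correspondence rhoY rhoZ C e) (e_ge0 : 0 <= e).

(** The additive error of potentials bounded by [M] that results from an error [e]
    of the kernels. *)
Definition distortion : R := e * expR (2 * M).

Local Notation k := distortion.

Let k_ge0 : 0 <= k. Proof. by rewrite mulr_ge0// expR_ge0. Qed.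

Let CYZ a b z w (s : R) : C a z -> C b w -> 0 <= s + 2 * M ->
  rhoY a b <= expR s -> rhoZ z w <= expR (s + k).
Proof.
by move=> az bw sM ab; apply: expR_perturb ab _ sM e_ge0; case: CP => _ _; apply.
Qed.

Let CZY a b z w (s : R) : C a z -> C b w -> 0 <= s + 2 * M ->
  rhoZ z w <= expR s -> rhoY a b <= expR (s + k).
Proof.
move=> az bw sM ab; apply: expR_perturb ab _ sM e_ge0.
by rewrite distrC; case: CP => _ _; apply.
Qed.

(** A tight function is determined by the kernel, so it takes nearly equal
    values at two points that the correspondence relates to the same one. *)
Lemma tight_fiber f a b z : tight rhoY f -> bounded_by M f -> C a z -> C b z ->
  f a <= f b + 2 * k.
Proof.
move=> ft fM az bz; have [_ fE] := ft; rewrite -{1}fE.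
apply/(conjugate_leP rhoYP _ _ fM) => c.
have [l _ _] := CP; have [w cw] := l c.
have := fM b; have := fM c; rewrite !ler_norml => /andP[? ?] /andP[? ?].
have := tight_feasible rhoYP ft b c => /(CYZ bz cw); have := k_ge0 => ? /(_ ltac:(lra)).
move=> /(CZY az cw).
move=> /(_ ltac:(lra)) /le_trans; apply; rewrite ler_expR; lra.
Qed.

(** The constant [k] makes the pulled back function feasible before retraction. *)
Definition transfer (r : Z -> Y) (f : Y -> R) : Z -> R :=
  retract rhoZ (fun z => f (r z) + k).

Variable r : Z -> Y.
Hypothesis rC : forall z, C (r z) z.

Let pull (f : Y -> R) : Z -> R := fun z => f (r z) + k.

Let pull_bounded f : bounded_by M f -> bounded_by (M + k) (pull f).
Proof.
move=> fM z; have := fM (r z); rewrite !ler_norml /pull => /andP[? ?].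
by have := k_ge0; move=> ?; apply/andP; split; lra.
Qed.

Let pull_feasible f : tight rhoY f -> bounded_by M f -> feasible rhoZ (pull f).
Proof.
move=> ft fM z w; have := tight_feasible rhoYP ft (r z) (r w).
have := fM (r z); have := fM (r w); rewrite !ler_norml => /andP[? ?] /andP[? ?].
move=> /(CYZ (rC z) (rC w)).
move=> /(_ ltac:(lra)) /le_trans; apply.
by rewrite ler_expR /pull; have := k_ge0; lra.
Qed.

Lemma transfer_tight f : tight rhoY f -> bounded_by M f ->
  tight rhoZ (transfer r f).
Proof.
move=> ft fM.
exact: retract_tight rhoZP _ _ (pull_bounded fM) (pull_feasible ft fM).
Qed.

(** The pulled back potential already nearly coincides with its conjugate, so the
    retraction hardly moves it. *)
Lemma transfer_near f z : tight rhoY f -> bounded_by M f ->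
  `|transfer r f z - f (r z)| <= 4 * k.
Proof.
move=> ft fM; have pb := pull_bounded fM; have pf := pull_feasible ft fM.
rewrite ler_distl.
have : transfer r f z <= f (r z) + k := retract_le rhoZP pb pf z.
have : conjugate rhoZ (pull f) z <= transfer r f z.
  exact: (conjugate_le_retract rhoZP pb pf z).
suff : f (r z) <= conjugate rhoZ (pull f) z + 4 * k.
  by have := k_ge0; move=> *; apply/andP; split; lra.
have [_ fE] := ft; rewrite -{1}fE; apply/(conjugate_leP rhoYP _ _ fM) => b.
have [l _ _] := CP; have [w bw] := l b.
have kk := k_ge0; have := tight_fiber ft fM (rC w) bw.
have := conjugate_bounded rhoZP pb z; have := fM b.
rewrite !ler_norml => /andP[? ?] /andP[? ?] frw.
have := conjugateP rhoZP z w pb.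
have : expR (conjugate rhoZ (pull f) z + pull f w) <=
  expR (conjugate rhoZ (pull f) z + f b + 3 * k).
  by rewrite ler_expR /pull; lra.
move=> /[swap] /le_trans/[apply] /(CZY (rC z) bw).
move=> /(_ ltac:(lra)) /le_trans; apply; rewrite ler_expR; lra.
Qed.

Lemma transfer_close f g c : tight rhoY f -> bounded_by M f ->
  tight rhoY g -> bounded_by M g -> sup_close c f g ->
  sup_close c (transfer r f) (transfer r g).
Proof.
move=> ft fM gt gM fg; apply: (retract_close rhoZP (pull_bounded fM) _ (pull_bounded gM)).
- exact: pull_feasible.
- exact: pull_feasible.
- by move=> z; rewrite opprD addrACA subrr addr0; exact: fg.
Qed.

Lemma transfer0 : transfer r (fun=> 0) = fun=> 0.
Proof.
rewrite /transfer; under eq_fun do rewrite add0r; exact: retract_cst.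
Qed.

Lemma transfer_bounded f : tight rhoY f -> bounded_by M f ->
  bounded_by M (transfer r f).
Proof.
move=> ft fM z; rewrite -[_ z]subr0 -[X in _ - X]/((fun=> 0 : R) z) -transfer0.
apply: transfer_close => //; first exact: tight0.
  by move=> a; rewrite normr0; exact: le_trans (normr_ge0 _) (fM (r z)).
by move=> a; rewrite subr0; exact: fM.
Qed.

Lemma transfer_expand f g c : tight rhoY f -> bounded_by M f ->
  tight rhoY g -> bounded_by M g ->
  sup_close c (transfer r f) (transfer r g) -> sup_close (c + 12 * k) f g.
Proof.
move=> ft fM gt gM fg a; have [l _ _] := CP; have [z az] := l a.
have := transfer_near z ft fM; have := transfer_near z gt gM; have := fg z.
have := tight_fiber ft fM az (rC z); have := tight_fiber ft fM (rC z) az.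
have := tight_fiber gt gM az (rC z); have := tight_fiber gt gM (rC z) az.
rewrite !ler_norml => ? ? ? ? /andP[? ?] /andP[? ?] /andP[? ?].
by apply/andP; split; lra.
Qed.

End Transfer.

(** The two transfers are each near a pull back, and pulling back twice moves points
    within the fibres of the correspondence only. *)
Lemma transfer_surj {R : realType} (Y Z : Type) (rhoY : Y -> Y -> R)
    (rhoZ : Z -> Z -> R) C (e M : R) (r : Z -> Y) (s : Y -> Z) (g : Z -> R) :
  antipodal_kernel rhoY -> antipodal_kernel rhoZ ->
  correspondence rhoY rhoZ C e -> 0 <= e ->
  (forall z, C (r z) z) -> (forall a, C a (s a)) ->
  tight rhoZ g -> bounded_by M g ->
  sup_close (10 * distortion e M)
    (transfer rhoZ e M r (transfer rhoY e M s g)) g.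
Proof.
move=> rhoYP rhoZP CP e0 rC sC gt gM; have CP' := correspondence_sym CP.
set f := transfer rhoY e M s g.
have ft : tight rhoY f by exact: (transfer_tight rhoZP rhoYP CP').
have fM : bounded_by M f by exact: (transfer_bounded rhoZP rhoYP CP').
move=> z; have := transfer_near rhoYP rhoZP CP e0 rC z ft fM.
have := transfer_near rhoZP rhoYP CP' e0 sC (r z) gt gM; rewrite -/f.
have := tight_fiber rhoZP CP' e0 gt gM (rC z) (sC (r z)).
have := tight_fiber rhoZP CP' e0 gt gM (sC (r z)) (rC z).
rewrite !ler_norml => ? ? /andP[? ?] /andP[? ?].
by apply/andP; split; lra.
Qed.

(** * Separating and antipodal functions on compact spaces *)

Section Separating.
Context {R : realType} {Z : topologicalType} (rho : Z -> Z -> R).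
Hypothesis rhoS : separating rho.

Lemma separating_cvg (T : Type) (F : set_system T) {FF : Filter F}
    (f g : T -> Z) x y :
  f @ F --> x -> g @ F --> y -> rho (f t) (g t) @[t --> F] --> rho x y.
Proof.
move=> fx gy; have [c _ _ _] := rhoS.
apply: (@cvg_comp _ _ _ (fun t => (f t, g t)) (fun p => rho p.1 p.2) _ (nbhs (x, y))).
  exact: cvg_pair.
exact: (c (x, y)).
Qed.

Lemma separating_xx x : rho x x = 0.
Proof. by have [_ _ _ /(_ x x)[_ ->]] := rhoS. Qed.

Lemma separating_near x (d : R) : 0 < d -> \forall y \near x, rho x y < d.
Proof.
move=> d0; have := @separating_cvg _ (nbhs x) _ (fun=> x) id x x.
rewrite separating_xx => c; apply: (cvgr_lt _ _ d d0).
by apply: c; [exact: cvg_cst|exact: cvg_id].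
Qed.

Lemma conformal_moebius_equivalent (rho' : Z -> Z -> R) (f : Z -> R) :
  (forall x, 0 < f x) -> (forall x y, rho' x y = f x * f y * rho x y) ->
  moebius_equivalent rho rho'.
Proof.
move=> f0 fE x x' y y'; rewrite /= !inE !negb_or.
move=> /andP[/and3P[_ xy xy'] /andP[/andP[x'y x'y'] _]].
have n a b : a != b -> rho a b != 0 by move=> ?; rewrite gt_eqF// separating_gt0.
have f1 a : f a != 0 by rewrite gt_eqF.
by rewrite /cross_ratio !fE; field; rewrite !f1 !n.
Qed.

Hypothesis Zc : compact [set: Z].

(** Closeness in [rho] is uniform closeness of the functions [rho x]: the triples
    [(x, y, z)] with [rho x z] far from [rho y z] form a compact set, on which
    [rho x y] has a positive minimum. *)
Lemma separating_modulus (e : R) : 0 < e -> exists2 d : R, 0 < d &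
  forall x y z, rho x y < d -> `|rho x z - rho y z| < e.
Proof.
move=> e0; have cT : compact [set: Z * Z * Z].
  by rewrite -!setXTT; apply: compact_setX => //; exact: compact_setX.
have [_ rC rge rE] := rhoS.
pose g (p : Z * Z * Z) := `|rho p.1.1 p.2 - rho p.1.2 p.2|.
have c1 : continuous (fun p : Z * Z * Z => p.1.1).
  by move=> p; apply: cvg_comp; exact: cvg_fst.
have c2 : continuous (fun p : Z * Z * Z => p.1.2).
  by move=> p; apply: cvg_comp; [exact: cvg_fst|exact: cvg_snd].
have c3 : continuous (fun p : Z * Z * Z => p.2) by move=> p; exact: cvg_snd.
have cg : continuous g.
  move=> p; apply: cvg_norm; apply: cvgB; apply: separating_cvg.
  - exact: c1.
  - exact: c3.
  - exact: c2.
  - exact: c3.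
pose K := g @^-1` [set t | e <= t].
have cK : compact K.
  apply: subclosed_compact cT _ => //.
  by move/continuous_closedP: cg; apply; exact: closed_ge.
have [K0|K0] := pselect (K !=set0); last first.
  exists 1 => // x y z _; rewrite ltNge; apply/negP => xyz; apply: K0.
  by exists (x, y, z).
have [|p] := @compact_EVT_min _ _ (fun p => rho p.1.1 p.1.2) K K0 cK.
  apply: continuous_subspaceT => p; apply: separating_cvg; [exact: c1|exact: c2].
rewrite inE => Kp pmin; exists (rho p.1.1 p.1.2).
  rewrite lt_neqAle rge andbT eq_sym; apply/eqP => /rE p12.
  by move: Kp; rewrite /K/= /g p12 subrr normr0 leNgt e0.
move=> x y z xy; rewrite ltNge; apply/negP => xyz.
have := pmin (x, y, z); rewrite inE => /(_ xyz) /=.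
by rewrite leNgt xy.
Qed.

Lemma separating_modulus2 (e : R) : 0 < e -> exists2 d : R, 0 < d &
  forall x y z w, rho x z < d -> rho y w < d -> `|rho x y - rho z w| < e.
Proof.
move=> e0; have e2 : 0 < e / 2 by rewrite divr_gt0.
have [d d0 dP] := separating_modulus e2; exists d => // x y z w xz yw.
have [_ rC _ _] := rhoS; have := dP _ _ y xz; have := dP _ _ z yw.
rewrite (rC y z) (rC w z) !ltr_distl => /andP[? ?] /andP[? ?].
by apply/andP; split; lra.
Qed.

End Separating.

Section AntipodalTopology.
Context {R : realType} {Z : topologicalType} (rho : Z -> Z -> R).
Hypotheses (Zc : compact [set: Z]) (rhoA : antipodal rho).

Lemma antipodal_kernelP : antipodal_kernel rho.
Proof.
have [[_ rC rge _] s1 ex] := rhoA; split => // x y; rewrite rge/= -s1.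
apply: sup_upper_bound; last by exists (x, y).
by apply: contrapT => /sup_out; rewrite s1 => /eqP; rewrite oner_eq0.
Qed.

Let rhoK := antipodal_kernelP.
Let rhoS : separating rho. Proof. by case: rhoA. Qed.

(** The modulus depends on the bound [M] but not on the tight function. *)
Lemma tight_equicontinuous (M e : R) : 0 < e -> exists2 d : R, 0 < d &
  forall h x y, tight rho h -> bounded_by M h -> rho x y < d -> `|h x - h y| <= e.
Proof.
move=> e0; have e1 : 0 < e * expR (- (2 * M)) by rewrite mulr_gt0// expR_gt0.
have [d d0 dP] := separating_modulus rhoS Zc e1; exists d => // h x y ht hM.
have main a b : rho b a < d -> h a <= h b + e.
  move=> ab; have [_ hE] := ht; rewrite -{1}hE.
  apply/(conjugate_leP rhoK _ _ hM) => z.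
  have := hM b; have := hM z; rewrite !ler_norml => /andP[? ?] /andP[? ?].
  have := expR_perturb (tight_feasible rhoK ht b z) (ltW (dP _ _ z ab)).
  move=> /(_ M) /(_ ltac:(lra) (ltW e1)).
  by rewrite -mulrA -expRD addNr expR0 mulr1 addrAC.
move=> xy; rewrite ler_distl lerBlDr !main//.
by have [_ -> _ _] := rhoS.
Qed.

Lemma tight_continuous h : tight rho h -> continuous h.
Proof.
move=> ht x; have [[M hM] _] := ht; apply/cvgrPdist_le => e e0.
have [d d0 dP] := tight_equicontinuous M e0.
by near=> y; apply: dP => //; near: y; exact: (separating_near rhoS).
Unshelve. all: by end_near. Qed.

(** By compactness the supremum that defines the conjugate is attained. *)
Lemma tight_partner h x : tight rho h -> exists y, rho x y = expR (h x + h y).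
Proof.
move=> ht; have hc := tight_continuous ht.
have [||y _ ymax] := @compact_EVT_max _ _ (fun y => rho x y * expR (- h y)) _ _ Zc.
- by exists x.
- apply: continuous_subspaceT => y; apply: cvgM.
    by apply: separating_cvg => //; exact: cvg_cst.
  by apply: continuous_cvg; [exact: continuous_expR|apply: cvgN; exact: hc].
exists y; apply/eqP; rewrite eq_le tight_feasible//= leNgt; apply/negP => lt.
have r0 : 0 < rho x y * expR (- h y).
  have [z xz] := let: And3 _ _ a := rhoK in a x.
  apply: lt_le_trans (ymax z _); last by rewrite inE.
  by rewrite xz mul1r expR_gt0.
have [[M hM] hE] := ht.
have : conjugate rho h x <= ln (rho x y * expR (- h y)).
  apply/(conjugate_leP rhoK _ _ hM) => z; rewrite expRD lnK//.
  by rewrite -ler_pdivrMr ?expR_gt0// -expRN ymax// inE.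
rewrite hE leNgt => /negP; apply; rewrite -ltr_expR lnK//.
by rewrite expRN ltr_pdivrMr ?expR_gt0// -expRD.
Qed.

End AntipodalTopology.

(** * Potentials of points of a Moebius space *)

Section Potential.
Context {R : realType} (Z : antipodalSpace R).
Implicit Types (mu nu : moebiusSpace Z) (h : Z -> R).
Local Notation rho := (@antipodal_fun R Z).

Lemma antipodal_space_kernel : antipodal_kernel rho.
Proof. exact: antipodal_kernelP (antipodal_funP Z). Qed.

Let rhoK := antipodal_space_kernel.
Let Zc := @antipodal_compact R Z.
Let rhoA := antipodal_funP Z.
Let rhoS : separating rho. Proof. by case: rhoA. Qed.
Let muS mu : separating mu. Proof. by case: (moebius_antipodal mu). Qed.
Let Z4 := @antipodal_four_points R Z.

(** The sign and the factor make [mu x y = rho x y * exp (- h x - h y)]. *)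
Definition potential mu : Z -> R :=
  fun x => - ln (moebius_derivative rho mu x) / 2.

Let derivP mu : is_moebius_derivative rho mu (moebius_derivative rho mu).
Proof. by apply: moebius_derivative_exists => //; exact: moebius_equiv. Qed.

Let derivE mu x : moebius_derivative rho mu x = expR (- (2 * potential mu x)).
Proof.
have [_ p _] := derivP mu; rewrite /potential mulrCA mulfV ?pnatr_eq0//.
by rewrite mulr1 opprK lnK// posrE.
Qed.

Lemma potentialE mu x y :
  mu x y = rho x y * expR (- potential mu x - potential mu y).
Proof.
have [_ _ E] := derivP mu; have := E x y; rewrite !derivE -expRD.
have -> : - (2 * potential mu x) + - (2 * potential mu y) =
  (- potential mu x - potential mu y) + (- potential mu x - potential mu y) by lra.
rewrite expRD -expr2 -exprMn => /eqP; rewrite eqrXn2//.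
- by move=> /eqP ->; rewrite mulrC.
- by case: (muS mu).
- by rewrite mulr_ge0// ?expR_ge0//; case: rhoS.
Qed.

Lemma potential_tight mu : tight rho (potential mu).
Proof.
have b : exists M, bounded_by M (potential mu).
  have [c p _] := derivP mu; have [z _] := fresh_point Z4 (s := [::]) isT.
  have [||x _ xmax] := @compact_EVT_max _ _ (fun y => `|potential mu y|) _ _ Zc.
  - by exists z.
  - apply: continuous_subspaceT => x; apply: cvg_norm.
    apply: cvgM; last exact: cvg_cst.
    by apply: cvgN; apply: continuous_cvg; [exact: continuous_ln|exact: c].
  by exists `|potential mu x| => y; apply: xmax; rewrite inE.
split => // x; have [M hM] := b; have [_ mle mex] := antipodal_kernelP (moebius_antipodal mu).
have E y : rho x y = mu x y * expR (potential mu x + potential mu y).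
  by rewrite potentialE -mulrA -expRD -opprD addNr expR0 mulr1.
apply/eqP; rewrite eq_le; apply/andP; split.
  apply/(conjugate_leP rhoK _ _ hM) => y; rewrite E ler_piMl ?expR_ge0//.
  by case/andP: (mle x y).
have [y xy] := mex x; have := conjugateP rhoK x y hM.
by rewrite E xy mul1r ler_expR lerD2r.
Qed.

(** The function [rho x y * exp (- h x - h y)] is antipodal: feasibility bounds it by
    [1], and [tight_partner] provides the antipodes. *)
Lemma tight_potential h : tight rho h -> exists mu, potential mu = h.
Proof.
move=> ht; pose f x y := rho x y * expR (- h x - h y).
have hc := tight_continuous Zc rhoA ht.
have [_ rC rge rE] := rhoS.
have fS : separating f.
  split.
  - move=> p; apply: cvgM; first by have [c _ _ _] := rhoS; exact: c.
    apply: continuous_cvg; first exact: continuous_expR.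
    apply: cvgB.
      by apply: cvgN; apply: continuous_cvg; [exact: hc|exact: cvg_fst].
    by apply: continuous_cvg; [exact: hc|exact: cvg_snd].
  - by move=> x y; rewrite /f rC addrC.
  - by move=> x y; rewrite mulr_ge0 ?rge ?expR_ge0.
  - move=> x y; rewrite -rE /f; split => [/eqP|->]; last by rewrite mul0r.
    by rewrite mulf_eq0 expR_eq0 orbF => /eqP.
have f1 x y : f x y <= 1.
  by rewrite /f -opprD expRN ler_pdivrMr ?expR_gt0// mul1r; exact: tight_feasible.
have fex x : exists y, f x y = 1.
  have [y xy] := tight_partner Zc rhoA x ht; exists y.
  by rewrite /f xy -expRD -opprD subrr expR0.
have fA : antipodal f.
  split => //; have [z _] := fresh_point Z4 (s := [::]) isT.
  have [w zw] := fex z.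
  apply/eqP; rewrite eq_le; apply/andP; split.
    by apply: ge_sup; [exists (f z z), (z, z)|move=> _ [[x y] _ <-]; exact: f1].
  rewrite -{1}zw; apply: ub_le_sup; last by exists (z, w).
  by exists 1 => _ [[x y] _ <-]; exact: f1.
have fE : moebius_equivalent rho f.
  apply: (conformal_moebius_equivalent rhoS (f := fun x => expR (- h x))).
    by move=> x; rewrite expR_gt0.
  by move=> x y; rewrite /f mulrC expRD.
exists (MoebiusSpace fA fE); apply/funext => x.
rewrite /potential; set mu := MoebiusSpace fA fE.
suff <- : (fun x => expR (- (2 * h x))) = moebius_derivative rho mu.
  by rewrite expRK opprK mulrAC mulfV ?mul1r// pnatr_eq0.
apply/(moebius_derivativeP Z4) => //.
split => [y|y|y z]; first 2 [by rewrite expR_gt0].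
  apply: continuous_cvg; first exact: continuous_expR.
  by apply: cvgN; apply: cvgM; [exact: cvg_cst|exact: hc].
rewrite /= /f exprMn [LHS]mulrC; congr (_ * _).
by rewrite -[LHS]expRM_natl -[RHS]expRD; congr expR; lra.
Qed.

Lemma potential_base : potential (moebius_base Z) = fun=> 0.
Proof.
apply/funext => x; rewrite /potential.
suff <- : (fun=> 1) = moebius_derivative rho (moebius_base Z) by rewrite ln1 oppr0 mul0r.
apply/(moebius_derivativeP Z4) => //.
by split => [y|y|y z]; [exact: cvg_cst|exact: ltr01|rewrite !mul1r].
Qed.

Let derivD mu nu x :
  moebius_derivative mu nu x = expR (2 * (potential mu x - potential nu x)).
Proof.
have [cm _ _] := derivP mu; have [cn _ _] := derivP nu.
suff <- : (fun x => expR (2 * (potential mu x - potential nu x))) =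
  moebius_derivative mu nu by [].
apply/(moebius_derivativeP Z4) => //.
  by move=> a a' b b' u; rewrite -!moebius_equiv.
split => [y|y|y z]; first 2 [by rewrite expR_gt0].
  apply: continuous_cvg; first exact: continuous_expR.
  apply: cvgM; first exact: cvg_cst.
  apply: cvgB; exact: (tight_continuous Zc rhoA (potential_tight _)).
rewrite !potentialE !exprMn [RHS]mulrCA; congr (_ * _).
by rewrite -!(expRM_natl 2) -!expRD; congr expR; lra.
Qed.

Lemma mdist_le_potential (c : R) mu nu :
  mdist mu nu <= c <-> forall x, 2 * `|potential mu x - potential nu x| <= c.
Proof.
rewrite moebius_mdistE /moebius_dist.
have E x : `|ln (moebius_derivative mu nu x)| = 2 * `|potential mu x - potential nu x|.
  by rewrite derivD expRK normrM ger0_norm.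
under [in sup _]eq_fun do rewrite E.
have [z _] := fresh_point Z4 (s := [::]) isT.
have [[M mM] _] := potential_tight mu; have [[N nN] _] := potential_tight nu.
split => [le x|le].
  apply: le_trans le; apply: ub_le_sup; last by exists x.
  exists (2 * (M + N)) => _ [y _ <-]; rewrite ler_wpM2l//.
  by apply: le_trans (ler_normB _ _) _; rewrite lerD.
by apply: ge_sup; [eexists; exists z|move=> _ [y _ <-]].
Qed.

Lemma mdist_potential mu nu x : 2 * `|potential mu x - potential nu x| <= mdist mu nu.
Proof. exact: (mdist_le_potential _ _ _).1. Qed.

(** Where the difference of the potentials is most negative, the antipode for [nu]
    makes it most positive. *)
Lemma mdist_attained mu nu :
  exists x, mdist mu nu = 2 * (potential mu x - potential nu x).
Proof.
have [z _] := fresh_point Z4 (s := [::]) isT.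
have pc m : continuous (potential m) := tight_continuous Zc rhoA (potential_tight m).
have [||x _ xmax] := @compact_EVT_max _ _ (fun y => `|potential mu y - potential nu y|) _ _ Zc.
- by exists z.
- by apply: continuous_subspaceT => x; apply: cvg_norm; apply: cvgB; exact: pc.
have xE : mdist mu nu = 2 * `|potential mu x - potential nu x|.
  apply/eqP; rewrite eq_le mdist_potential andbT; apply/mdist_le_potential => y.
  by rewrite ler_wpM2l// xmax// inE.
rewrite xE; have [ge0|lt0] := lerP 0 (potential mu x - potential nu x).
  by exists x; rewrite ger0_norm.
have [y xy] := tight_partner Zc rhoA x (potential_tight nu).
have := tight_feasible rhoK (potential_tight mu) x y.
rewrite xy ler_expR => le; exists y; congr (2 * _).
have := xmax y; rewrite inE => /(_ I); rewrite (ltr0_norm lt0) ler_norml => /andP[_ ?].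
by apply/eqP; rewrite eq_le; apply/andP; split; lra.
Qed.

Lemma potential_inj mu nu : potential mu = potential nu -> mu = nu.
Proof.
move=> E; apply: mdist_positivity; apply/eqP; rewrite eq_le mdist_ge0 andbT.
by apply/mdist_le_potential => x; rewrite E subrr normr0 mulr0.
Qed.

Lemma potential_bounded (r : R) mu :
  mdist (moebius_base Z) mu <= r <-> bounded_by (r / 2) (potential mu).
Proof.
rewrite mdist_le_potential potential_base; split => H x; have := H x.
  by rewrite sub0r normrN; lra.
by rewrite sub0r normrN; lra.
Qed.

End Potential.

(** * Gromov-Hausdorff convergence of Moebius spaces *)

Section AlmostIsometry.
Context {R : realType}.

Lemma AI_isometryW (Y Z : Type) (rhoY : Y -> Y -> R) (rhoZ : Z -> Z -> R)
    (d e : R) (f : Y -> Z) :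
  d <= e -> AI_isometry rhoY rhoZ d f -> AI_isometry rhoY rhoZ e f.
Proof.
move=> de [s h]; split; first by apply: lt_le_trans s _; rewrite lee_fin.
by move=> z; have [y yz] := h z; exists y; exact: lt_le_trans yz de.
Qed.

Lemma AI_isometry_lt (Y Z : Type) (rhoY : Y -> Y -> R) (rhoZ : Z -> Z -> R)
    (e : R) (f : Y -> Z) a b :
  AI_isometry rhoY rhoZ e f -> `|rhoZ (f a) (f b) - rhoY a b| < e.
Proof.
move=> [s _]; rewrite -lte_fin; apply: le_lt_trans s.
by apply: ereal_sup_ubound; exists (a, b).
Qed.

Lemma AI_converges_isometry (Z_ : nat -> Type) (rho_ : forall n, Z_ n -> Z_ n -> R)
    (Z : Type) (rho : Z -> Z -> R) (e : R) :
  AI_converges rho_ rho -> 0 < e ->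
  exists n0, forall n, (n0 <= n)%N -> exists f, AI_isometry (@rho_ n) rho e f.
Proof.
move=> cv e0; have : nbhs (0%E : \bar R) [set x | (x < e%:E)%E].
  by apply: open_nbhs_nbhs; split; [exact: open_ereal_lt_ereal|rewrite /= lte_fin].
move=> /cv [n0 _ n0P]; exists n0 => n /n0P /= /ereal_inf_lt.
move=> [_ [d [d0 [[f fP] _]] <-]]; rewrite lte_fin => de.
by exists f; apply: AI_isometryW fP; exact: ltW.
Qed.

(** Only the modulus of continuity of the target enters, so [d] is uniform over the
    sources. *)
Lemma AI_isometry_correspondence (Z : topologicalType) (rhoZ : Z -> Z -> R)
    (e : R) :
  compact [set: Z] -> separating rhoZ -> 0 < e ->
  exists2 d : R, 0 < d &
    forall (Y : Type) (rhoY : Y -> Y -> R) f, AI_isometry rhoY rhoZ d f ->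
      exists C, correspondence rhoY rhoZ C e.
Proof.
move=> Zc rhoS e0; have e2 : 0 < e / 2 by rewrite divr_gt0.
have [d d0 dP] := separating_modulus2 rhoS Zc e2.
exists (Num.min d (e / 2)); first by rewrite lt_min d0.
move=> Y rhoY f fP; exists (fun a z => rhoZ (f a) z < d); split.
- by move=> a; exists (f a); rewrite (separating_xx rhoS).
- move=> z; have [_ /(_ z) [a]] := fP; rewrite lt_min => /andP[az _].
  by exists a.
- move=> a b z w az bw; have := dP _ _ _ _ az bw.
  have := AI_isometry_lt a b fP; rewrite lt_min => /andP[_].
  rewrite !ltr_norml ler_norml => /andP[? ?] /andP[? ?].
  by apply/andP; split; lra.
Qed.

End AlmostIsometry.

(** Distances are twice the differences of potentials, so the error [12 * k] of
    [transfer_expand] becomes [24 * k]; the constant [25] makes the bound strict. *)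
Lemma moebius_eps_isometry {R : realType} (Y Z : antipodalSpace R) C (e r : R) :
  correspondence (@antipodal_fun R Y) (@antipodal_fun R Z) C e ->
  0 < e -> 0 < r -> exists f : moebiusSpace Y -> moebiusSpace Z,
    eps_isometry (cball (moebius_base Y) r) (cball (moebius_base Z) r)
      (25 * (e * expR r)) f /\ f (moebius_base Y) = moebius_base Z.
Proof.
move=> CP e0 r0; set k := e * expR r; have k0 : 0 < k by rewrite mulr_gt0// expR_gt0.
have kE : distortion e (r / 2) = k.
  by rewrite /distortion /k mulrCA mulfV ?mulr1// pnatr_eq0.
have rY := antipodal_space_kernel Y; have rZ := antipodal_space_kernel Z.
have CP' := correspondence_sym CP.
have [l t _] := CP; have [b bC] := choice l; have [a aC] := choice t.
have /choice[f fP] : forall mu : moebiusSpace Y, exists nu : moebiusSpace Z,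
    bounded_by (r / 2) (potential mu) ->
      potential nu = transfer (@antipodal_fun R Z) e (r / 2) a (potential mu).
  move=> mu.
  have [mub|mub] := pselect (bounded_by (r / 2) (potential mu)); last first.
    by exists (moebius_base Z).
  have [nu nuE] := tight_potential
    (transfer_tight rY rZ CP (ltW e0) aC (potential_tight mu) mub).
  by exists nu.

have fb mu : bounded_by (r / 2) (potential mu) -> bounded_by (r / 2) (potential (f mu)).
  move=> mub; rewrite fP//.
  exact: (transfer_bounded rY rZ CP (ltW e0) aC (potential_tight mu)).
exists f; split; last first.
  apply: potential_inj; rewrite fP; last first.
    by apply/potential_bounded; rewrite mdistxx ltW.
  by rewrite !potential_base; exact: (transfer0 _ rZ (ltW e0)).
split.
- by move=> mu /potential_bounded mub; apply/potential_bounded/fb.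
- apply: le_lt_trans (_ : ((24 * k)%:E < _)%E); last by rewrite lte_fin; lra.
  apply: ge_ereal_sup => _ [[mu nu] [/potential_bounded mub /potential_bounded nub] <-] /=.
  rewrite lee_fin ler_distl; apply/andP; split.
    rewrite lerBlDr; apply/mdist_le_potential => y.
    have := transfer_expand rY rZ CP (ltW e0) aC (c := mdist (f mu) (f nu) / 2)
      (potential_tight mu) mub (potential_tight nu) nub.
    rewrite -!fP// kE => /(_ _ y); rewrite -ler_pdivlMl// => H.
    rewrite mulrC; apply: le_trans (H _) _; last by lra.
    by move=> z; have := mdist_potential (f mu) (f nu) z; lra.
  apply/mdist_le_potential => z.
  have := transfer_close rY rZ CP (ltW e0) aC (c := mdist mu nu / 2)
    (potential_tight mu) mub (potential_tight nu) nub.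
  rewrite -!fP// => /(_ _ z) H.
  have : `|potential (f mu) z - potential (f nu) z| <= mdist mu nu / 2.
    by apply: H => y; have := mdist_potential mu nu y; lra.
  lra.
- move=> nu /potential_bounded nub.
  have gb := transfer_bounded rZ rY CP' (ltW e0) bC (potential_tight nu) nub.
  have [mu muE] := tight_potential
    (transfer_tight rZ rY CP' (ltW e0) bC (potential_tight nu) nub).
  have mub : bounded_by (r / 2) (potential mu) by rewrite muE.
  exists mu; first exact/potential_bounded.
  apply/mdist_le_potential => z; rewrite fP// muE.
  have := transfer_surj rY rZ CP (ltW e0) aC bC (potential_tight nu) nub z.
  by rewrite kE; lra.
Qed.

Theorem moebius_pGH_converges {R : realType} (Z_ : nat -> antipodalSpace R)
    (Z : antipodalSpace R) :
  AI_converges (fun n : nat => @antipodal_fun R (Z_ n)) (@antipodal_fun R Z) ->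
  pGH_converges (fun n : nat => moebius_base (Z_ n)) (moebius_base Z).
Proof.
move=> cv r e r0 e0; pose e' := e / 25 * expR (- r).
have e'0 : 0 < e' by rewrite mulr_gt0 ?expR_gt0// divr_gt0.
have rhoS : separating (@antipodal_fun R Z) by have [] := antipodal_funP Z.
have [d d0 dP] := AI_isometry_correspondence (@antipodal_compact R Z) rhoS e'0.
have [n0 n0P] := AI_converges_isometry cv d0; exists n0 => n /n0P [g /dP[C CP]].
have [f] := moebius_eps_isometry CP e'0 r0.
rewrite /e' -mulrA -expRD addNr expR0 mulr1 mulrC divfK ?pnatr_eq0// => fP.
by exists f.
Qed.

(** * Geodesics in a Moebius space *)

Section MoebiusGeodesics.
Context {R : realType} (Z : antipodalSpace R).
Implicit Types mu nu : moebiusSpace Z.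
Local Notation rho := (@antipodal_fun R Z).

Let rhoK := antipodal_space_kernel Z.
Let rhoS : separating rho. Proof. by case: (antipodal_funP Z). Qed.

(** Feasible functions are stable under convex combinations, so retracting the
    affine segment between two potentials yields a curve that is 1-Lipschitz and
    joins two points at the distance of its parameters. *)
Lemma moebius_geodesic : geodesic_metric (moebiusSpace Z).
Proof.
move=> mu nu; set L := mdist mu nu.
have [L0|L0] := eqVneq L 0.
  exists (fun=> mu); split => //; first exact: mdist_positivity.
  move=> s t; rewrite L0 /= !in_itv/= -!eq_le => /eqP<- /eqP<-.
  by rewrite mdistxx subrr normr0.
have Lp : 0 < L by rewrite lt_neqAle eq_sym L0 mdist_ge0.
have tm := potential_tight mu; have tn := potential_tight nu.
have [[M mM] _] := tm; have [[N nN] _] := tn.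
pose h (s : R) x := (1 - s / L) * potential mu x + s / L * potential nu x.
have s01 (s : R) : 0 <= s <= L -> (0 <= s / L) && (s / L <= 1).
  move=> /andP[s0 sL]; rewrite divr_ge0 ?(ltW Lp)//=.
  by rewrite ler_pdivrMr// mul1r.
have hf (s : R) : 0 <= s <= L -> feasible rho (h s).
  move=> /s01; rewrite /h; set u := s / L => /andP[u0 u1] x y.
  have := tight_feasible rhoK tm x y; have := tight_feasible rhoK tn x y.
  have [->|] := eqVneq (rho x y) 0; first by rewrite expR_ge0.
  move=> r0; have {}r0 : 0 < rho x y.
    by rewrite lt_neqAle eq_sym r0/=; case: rhoS.
  rewrite -(lnK (x := rho x y))// !ler_expR; set w := ln _ => wn wm.
  have -> : (1 - u) * potential mu x + u * potential nu x +
      ((1 - u) * potential mu y + u * potential nu y) =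
    (1 - u) * (potential mu x + potential mu y) +
      u * (potential nu x + potential nu y) by ring.
  have : (1 - u) * w <= (1 - u) * (potential mu x + potential mu y).
    by rewrite ler_wpM2l// subr_ge0.
  by have := ler_wpM2l u0 wn; lra.
have hb (s : R) : 0 <= s <= L -> bounded_by (M + N) (h s).
  move=> /s01; rewrite /h; set u := s / L => /andP[u0 u1] x.
  have := mM x; have := nN x => n m.
  apply: le_trans (ler_normD _ _) _.
  rewrite [X in X + _]normrM [X in _ + X]normrM (ger0_norm u0).
  rewrite (ger0_norm (x := 1 - u)) ?subr_ge0//.
  by apply: lerD; [apply: le_trans m|apply: le_trans n]; rewrite ler_piMl//; lra.
have /choice[c cP] : forall s : R, exists m : moebiusSpace Z, 0 <= s <= L ->
    potential m = retract rho (h s).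
  move=> s; have [sL|_] := boolP (0 <= s <= L); last by exists mu.
  by have [m mE] := tight_potential (retract_tight rhoK (hb s sL) (hf s sL)); exists m.
have c0 : c 0 = mu.
  apply: potential_inj; rewrite cP ?lexx ?ltW// -[RHS](retract_id rhoK tm).
  by congr retract; apply/funext => x; rewrite /h mul0r subr0 mul1r mul0r addr0.
have cL : c L = nu.
  apply: potential_inj; rewrite cP ?lexx ?ltW// -[RHS](retract_id rhoK tn).
  by congr retract; apply/funext => x; rewrite /h divff// subrr mul0r mul1r add0r.
have le (s t : R) : 0 <= s <= L -> 0 <= t <= L -> mdist (c s) (c t) <= `|s - t|.
  move=> sL tL; apply/mdist_le_potential => x; rewrite !cP//.
  suff : `|retract rho (h s) x - retract rho (h t) x| <= `|s - t| / 2 by lra.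
  apply: (retract_close rhoK (hb _ sL) (hf _ sL) (hb _ tL) (hf _ tL)) => y.
  have -> : h s y - h t y = (s - t) / L * (potential nu y - potential mu y).
    by rewrite /h; ring.
  rewrite !normrM normfV (gtr0_norm Lp) -mulrA ler_wpM2l// ler_pdivrMl//.
  have := mdist_potential mu nu y; rewrite distrC -/L; lra.
exists c; split => // s t; rewrite /= !in_itv/= => sL tL.
apply/eqP; rewrite eq_le le//=.
have Lr : 0 <= L <= L by rewrite ltW/=.
have zr : 0 <= (0 : R) <= L by rewrite lexx ltW.
wlog st : s t sL tL / s <= t.
  move=> H; have [/H|/ltW/H] := leP s t; first exact.
  by rewrite metric_sym distrC; exact.
have := metric_triangle (c 0) (c s) (c L); have := metric_triangle (c s) (c t) (c L).
have : mdist (c 0) (c L) = L by rewrite c0 cL.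
have := le _ _ zr sL; have := le _ _ tL Lr.
rewrite sub0r normrN; case/andP: sL => s0 sL; case/andP: tL => t0 tL.
rewrite (ger0_norm s0) (ler0_norm (x := t - L)) ?subr_le0//.
have -> : `|s - t| = t - s by rewrite distrC ger0_norm// subr_ge0.
lra.
Qed.

(** Lowering a potential at one point and raising it by the same amount everywhere
    else preserves feasibility; the retraction of this family is a ray. *)
Lemma moebius_ray mu (xi : Z) : exists c : R -> moebiusSpace Z,
  [/\ c 0 = mu,
      forall t : R, 0 <= t -> potential (c t) xi = potential mu xi - t / 2 &
      forall s t : R, 0 <= s -> 0 <= t -> mdist (c s) (c t) <= `|s - t|].
Proof.
have tm := potential_tight mu; have [[M mM] _] := tm.
pose h (t : R) x := potential mu x + if x == xi then - (t / 2) else t / 2.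
have hf (t : R) : 0 <= t -> feasible rho (h t).
  move=> t0 x y; have [->|xy] := eqVneq x y.
    by rewrite (separating_xx rhoS) expR_ge0.
  apply: le_trans (tight_feasible rhoK tm x y) _; rewrite ler_expR /h.
  have [xE|_] := eqVneq x xi; have [yE|_] := eqVneq y xi; try lra.
  by rewrite xE yE eqxx in xy.
have hb (t : R) : 0 <= t -> bounded_by (M + t / 2) (h t).
  move=> t0 x; apply: le_trans (ler_normD _ _) _; apply: lerD => //.
  by case: ifP => _; rewrite ?normrN ger0_norm//; lra.
have /choice[c cP] : forall t : R, exists m : moebiusSpace Z, 0 <= t ->
    potential m = retract rho (h t).
  move=> t; have [t0|_] := boolP (0 <= t); last by exists mu.
  by have [m mE] := tight_potential (retract_tight rhoK (hb t t0) (hf t t0)); exists m.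
have c0 : c 0 = mu.
  apply: potential_inj; rewrite cP// -[RHS](retract_id rhoK tm).
  by congr retract; apply/funext => x; rewrite /h mul0r oppr0 if_same addr0.
have le (s t : R) : 0 <= s -> 0 <= t -> mdist (c s) (c t) <= `|s - t|.
  move=> s0 t0; apply/mdist_le_potential => x; rewrite !cP//.
  suff : `|retract rho (h s) x - retract rho (h t) x| <= `|s - t| / 2 by lra.
  have bs := bounded_byW (M' := M + (s + t) / 2) _ (hb _ s0).
  have bt := bounded_byW (M' := M + (s + t) / 2) _ (hb _ t0).
  apply: (retract_close rhoK (bs _) (hf _ s0) (bt _) (hf _ t0)); [lra|lra|].
  move=> y; rewrite /h opprD addrACA subrr add0r.
  case: ifP => _; rewrite -?opprD ?normrN -?mulNr -mulrDl.
    by rewrite normrM (ger0_norm (x := 2^-1))// opprK addrC distrC.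
  by rewrite normrM (ger0_norm (x := 2^-1))// opprK addrC distrC.
exists c; split => // t t0; apply/eqP; rewrite eq_le; apply/andP; split.
  rewrite cP//; have := retract_le rhoK (hb _ t0) (hf _ t0) xi.
  by rewrite {2}/h eqxx.
have := le _ _ t0 (lexx 0); rewrite c0 subr0 (ger0_norm t0) => ct.
have : `|potential (c t) xi - potential mu xi| <= t / 2.
  by have := mdist_potential (c t) mu xi; lra.
by rewrite ler_norml => /andP[? _]; lra.
Qed.

(** A segment from [p] to [q] is extended by a ray from [q] towards a point [xi]
    where the potential drops by the full distance, and backwards by a ray from [p]
    towards an antipode of [xi] for [p]. The value at [xi] is then affine in the
    parameter along the whole line, which bounds distances from below. *)
Lemma moebius_geodesically_complete : geodesically_complete (moebiusSpace Z).
Proof.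
move=> a b c ab ciso.
have aab : `[a, b]%classic a by rewrite /= in_itv/= lexx ab.
have bab : `[a, b]%classic b by rewrite /= in_itv/= lexx ab.
have [xi xiE] := mdist_attained (c a) (c b).
have Lab : mdist (c a) (c b) = b - a.
  by rewrite ciso// distrC ger0_norm// subr_ge0.
have [xi' pE] := tight_partner (@antipodal_compact R Z) (antipodal_funP Z) xi
  (potential_tight (c a)).
have [cr [cr0 crE crl]] := moebius_ray (c b) xi.
have [cl [cl0 clE cll]] := moebius_ray (c a) xi'.
pose c' s := if s < a then cl (a - s) else if s <= b then c s else cr (s - b).
have c'E (s : R) : potential (c' s) xi = potential (c a) xi - (s - a) / 2.
  rewrite /c'; case: ltP => [sa|sa].
    have as0 : 0 <= a - s by rewrite subr_ge0 ltW.
    have := tight_feasible rhoK (potential_tight (cl (a - s))) xi xi'.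
    rewrite pE ler_expR clE//.
    have := cll _ _ as0 (lexx 0); rewrite cl0 subr0 (ger0_norm as0).
    move=> /(mdist_le_potential _ _ _)/(_ xi); rewrite -ler_pdivlMl// ler_norml.
    by move=> /andP[? ?] ?; apply/eqP; rewrite eq_le; apply/andP; split; lra.
  case: leP => [sb|sb].
    have sab : `[a, b]%classic s by rewrite /= in_itv/= sa sb.
    have : mdist (c s) (c a) <= s - a by rewrite ciso// ger0_norm// subr_ge0.
    move=> /(mdist_le_potential _ _ _)/(_ xi); rewrite -ler_pdivlMl// ler_norml.
    have : mdist (c s) (c b) <= b - s by rewrite ciso// distrC ger0_norm// subr_ge0.
    move=> /(mdist_le_potential _ _ _)/(_ xi); rewrite -ler_pdivlMl// ler_norml.
    move=> /andP[? ?] /andP[? ?].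
    by apply/eqP; rewrite eq_le; apply/andP; split; lra.
  by rewrite crE ?subr_ge0 ?ltW//; lra.
have c'l (s t : R) : s <= t -> mdist (c' s) (c' t) <= t - s.
  have ll (s' t' : R) : s' <= t' -> t' <= a -> mdist (cl (a - s')) (cl (a - t')) <= t' - s'.
    move=> st ta; apply: le_trans (cll _ _ _ _) _; [lra|lra|].
    by rewrite (_ : _ - _ = t' - s') ?ger0_norm ?subr_ge0//; lra.
  have rr (s' t' : R) : s' <= t' -> b <= s' -> mdist (cr (s' - b)) (cr (t' - b)) <= t' - s'.
    move=> st ta; apply: le_trans (crl _ _ _ _) _; [lra|lra|].
    by rewrite distrC (_ : _ - _ = t' - s') ?ger0_norm ?subr_ge0//; lra.
  have cc (s' t' : R) : s' <= t' -> a <= s' -> t' <= b -> mdist (c s') (c t') <= t' - s'.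
    move=> st sa tb; rewrite ciso.
    - by rewrite distrC ger0_norm// subr_ge0.
    - by rewrite /= in_itv/= sa/= (le_trans st tb).
    - by rewrite /= in_itv/= tb andbT (le_trans sa st).
  move=> st; rewrite /c'; case: ltP => sa.
    have la : mdist (cl (a - s)) (c a) <= a - s.
      by rewrite -{1}cl0 -[in cl 0](subrr a); apply: ll => //; exact: ltW.
    case: ltP => ta; first by apply: ll => //; exact: ltW.
    case: (lerP t b) => tb.
      have := metric_triangle (cl (a - s)) (c a) (c t).
      by have := cc a t ta (lexx a) tb; lra.
    have := metric_triangle (cl (a - s)) (c a) (cr (t - b)).
    have := cc a b ab (lexx a) (lexx b); have := metric_triangle (c a) (c b) (cr (t - b)).
    have : mdist (c b) (cr (t - b)) <= t - b.
      by rewrite -{1}cr0 -[in cr 0](subrr b); apply: rr => //; exact: ltW.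
    lra.
  rewrite ltNge (le_trans sa st)/=; case: (lerP s b) => sb; case: (lerP t b) => tb.
  - exact: cc.
  - have := metric_triangle (c s) (c b) (cr (t - b)).
    have : mdist (c b) (cr (t - b)) <= t - b.
      by rewrite -{1}cr0 -[in cr 0](subrr b); apply: rr => //; exact: ltW.
    by have := cc s b sb sa (lexx b); lra.
  - by exfalso; lra.
  - by apply: rr => //; exact: ltW.
exists c'; split; last first.
  move=> s; rewrite in_itv/= /c' => /andP[sa sb].
  by rewrite ltNge sa/= sb.
move=> s t _ _; wlog st : s t / s <= t.
  move=> H; have [/H//|/ltW/H] := leP s t.
  by rewrite metric_sym distrC.
rewrite distrC ger0_norm ?subr_ge0//; apply/eqP; rewrite eq_le c'l//=.
have := mdist_potential (c' s) (c' t) xi; rewrite !c'E => H.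
apply: le_trans H; rewrite -ler_pdivrMl//; apply: le_trans (ler_norm _); lra.
Qed.

End MoebiusGeodesics.

(** * Uniform metrics, ultrafilters and properness *)

(** The point of [Z] excludes suprema of empty sets. *)
Record supFamily (R : realType) (T Z : Type) := SupFamily {
  sup_fun :> T -> Z -> R;
  sup_fun01 : forall t z, 0 <= sup_fun t z <= 1;
  sup_fun_inj : injective sup_fun;
  sup_point : Z }.

(** An alias of [T] that carries the uniform distance of the family [J]. *)
Definition sup_space (R : realType) (T Z : Type) (J : supFamily R T Z) : Type := T.

Section SupMetric.
Context {R : realType} {T Z : Type} (J : supFamily R T Z).

Definition sup_dist (p q : T) : R := sup (range (fun z => `|J p z - J q z|)).

Lemma sup_dist_leP (c : R) p q :
  sup_dist p q <= c <-> forall z, `|J p z - J q z| <= c.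
Proof.
split => [le z|le].
  apply: le_trans le; apply: ub_le_sup; last by exists z.
  exists 1 => _ [w _ <-].
  have /andP[? ?] := sup_fun01 J p w; have /andP[? ?] := sup_fun01 J q w.
  by rewrite ler_norml; apply/andP; split; lra.
apply: ge_sup; first by eexists; exists (sup_point J).
by move=> _ [z _ <-].
Qed.

Lemma sup_dist_ge p q z : `|J p z - J q z| <= sup_dist p q.
Proof. exact: (sup_dist_leP _ _ _).1. Qed.

Let sup_distxx p : sup_dist p p = 0.
Proof.
apply/eqP; rewrite eq_le; apply/andP; split.
  by apply/sup_dist_leP => z; rewrite subrr normr0.
exact: le_trans (normr_ge0 _) (sup_dist_ge p p (sup_point J)).
Qed.

Let sup_dist_positivity p q : sup_dist p q = 0 -> p = q.
Proof.
move=> d0; apply: (@sup_fun_inj _ _ _ J); apply/funext => z; apply/eqP.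
by rewrite -subr_eq0 -normr_le0 -d0 sup_dist_ge.
Qed.

Let sup_dist_sym p q : sup_dist p q = sup_dist q p.
Proof.
apply/eqP; rewrite eq_le; apply/andP.
by split; apply/sup_dist_leP => z; rewrite distrC sup_dist_ge.
Qed.

Let sup_dist_triangle q p r : sup_dist p r <= sup_dist p q + sup_dist q r.
Proof.
apply/sup_dist_leP => z; rewrite -(subrK (J q z) (J p z)) -addrA.
by apply: le_trans (ler_normD _ _) _; apply: lerD; exact: sup_dist_ge.
Qed.

HB.instance Definition _ := gen_eqMixin (sup_space J).
HB.instance Definition _ := gen_choiceMixin (sup_space J).
HB.instance Definition _ := isMetric.Build R (sup_space J)
  sup_distxx sup_dist_positivity sup_dist_sym sup_dist_triangle.

Lemma mdist_sup_leP (c : R) (p q : sup_space J) :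
  mdist p q <= c <-> forall z, `|J p z - J q z| <= c.
Proof. exact: sup_dist_leP. Qed.

End SupMetric.

Lemma compact_metric_second_countable {R : realType} (T : metricType R) (p : T) :
  compact [set: T] -> @second_countable T.
Proof.
pose T' : pseudoPMetricType R := HB.pack (T : Type) (isPointed.Build T p) T.
exact: (@compact_second_countable R T').
Qed.

Section Ultrafilters.

Lemma ultra_fmap (T U : Type) (f : T -> U) (F : set_system T) :
  UltraFilter F -> UltraFilter (f @ F).
Proof.
move=> FU; split => [|G GF FG]; first exact: fmap_proper_filter.
apply/seteqP; split; last exact: FG.
move=> A GA; have [//|FA] := in_ultra_setVsetC (f @^-1` A) FU.
have : G (~` A) by exact: FG.
by move=> /(filterI GA); rewrite setICr => /filter_not_empty.
Qed.

Lemma ultra_cvg_compact (T : Type) (U : topologicalType) (f : T -> U)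
    (F : set_system T) (K : set U) :
  UltraFilter F -> compact K -> F (f @^-1` K) -> exists2 p, K p & f @ F --> p.
Proof.
move=> FU; rewrite compact_ultra => cK FK.
by have [p [Kp fp]] := cK _ (ultra_fmap f FU) FK; exists p.
Qed.

End Ultrafilters.

Section Embedding.
Context {X H : topologicalType} (i : X -> H).

Lemma embedding_open : continuous i ->
  (forall x (A : set X), nbhs x A -> exists2 V, nbhs (i x) V & i @^-1` V `<=` A) ->
  forall A : set X, open A <-> exists2 U, open U & i @^-1` U = A.
Proof.
move=> ic ie A; split => [oA|[U oU <-]]; last by move/continuousP: ic; exact.
exists (\bigcup_(V in [set V | open V /\ i @^-1` V `<=` A]) V).
  by apply: bigcup_open => V [].
apply/seteqP; split => [x [V [_ VA] Vx]|x Ax]; first exact: VA.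
have [V] := ie x A (open_nbhs_nbhs (conj oA Ax)).
rewrite nbhsE => -[W [oW Wx] WV VA]; exists W => //; split => //.
by move=> y /WV; exact: VA.
Qed.

End Embedding.

Section UniformLimits.
Context {R : realType} (Z : antipodalSpace R).
Implicit Types mu nu : moebiusSpace Z.
Local Notation rho := (@antipodal_fun R Z).

Let rhoK := antipodal_space_kernel Z.
Let rhoS : separating rho. Proof. by case: (antipodal_funP Z). Qed.

(** Potentials of bounded size are equicontinuous, so a pointwise limit along an
    ultrafilter is a uniform one, and tightness passes to uniform limits. *)
Lemma moebius_ultra_cvg (r : R) (F : set_system (moebiusSpace Z)) :
  UltraFilter F -> F (cball (moebius_base Z) r) -> exists mu, F --> mu.
Proof.
move=> FU Fr; pose M := r / 2.
have FM : \forall mu \near F, bounded_by M (potential mu).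
  by apply: filterS Fr => mu /potential_bounded.
have /choice[h hP] : forall z, exists l : R,
    `|l| <= M /\ potential mu z @[mu --> F] --> l.
  move=> z.
  have [||l] := @ultra_cvg_compact _ _ (fun mu => potential mu z) F `[- M, M]%classic FU.
  - exact: segment_compact.
  - by apply: filterS FM => mu /(_ z); rewrite /= in_itv/= ler_norml.
  by rewrite /= in_itv/= -ler_norml => lM ?; exists l.
have uni (e : R) : 0 < e -> \forall mu \near F, sup_close e (potential mu) h.
  move=> e0; have e3 : 0 < e / 3 by rewrite divr_gt0.
  have [d d0 dP] := tight_equicontinuous (@antipodal_compact R Z) (antipodal_funP Z) M e3.
  have hd x y : rho x y < d -> `|h x - h y| <= e / 3.
    move=> xy; have [_ hx] := hP x; have [_ hy] := hP y.
    apply: (cvgr_to_le (cvg_norm (cvgB hx hy))).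
    by apply: filterS FM => mu muM; apply: dP => //; exact: potential_tight.
  have : \forall mu \near F, [set: Z] `<=` (fun x => `|potential mu x - h x| <= e).
    apply: (iffLR (@compact_near_coveringP _ _) (@antipodal_compact R Z)) => x _.
    have nx : \forall y \near x, rho x y < d by exact: separating_near.
    have nF : \forall mu \near F, bounded_by M (potential mu) /\
        `|potential mu x - h x| < e / 3.
      apply: filterI FM _; have [_ hx] := hP x.
      move/cvgrPdist_lt: hx => /(_ _ e3).
      by apply: filterS => mu; rewrite distrC.
    exists ([set y | rho x y < d], [set mu | bounded_by M (potential mu) /\
        `|potential mu x - h x| < e / 3]) => //.
    move=> [y mu] [/= xy [muM mux]].
    have := dP _ _ _ (potential_tight mu) muM xy; have := hd _ _ xy.
    move: mux; rewrite ltr_norml !ler_norml => /andP[? ?] /andP[? ?] /andP[? ?].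
    by apply/andP; split; lra.
  by apply: filterS => mu muh x; exact: muh.
have hM : bounded_by M h by move=> z; have [] := hP z.
have ht : tight rho h.
  split; first by exists M.
  move=> x; apply/eqP; rewrite -subr_eq0 -normr_le0; apply/ler_addgt0Pr => e e0.
  have e2 : 0 < e / 2 by rewrite divr_gt0.
  have [mu [muh muM]] := filter_ex (filterI (uni _ e2) FM).
  have := conjugate_close rhoK muM hM muh x; have [_ ->] := potential_tight mu.
  have := muh x; rewrite add0r !ler_norml => /andP[? ?] /andP[? ?].
  by apply/andP; split; lra.
have [mu muE] := tight_potential ht; exists mu.
apply/metricType_numDomainType.fcvgrPdist_lt => e e0.
have e4 : 0 < e / 4 by rewrite divr_gt0.
apply: filterS (uni _ e4) => nu nuh; apply: (@le_lt_trans _ _ (e / 2)); last by lra.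
apply/mdist_le_potential => x; have := nuh x; rewrite muE distrC; lra.
Qed.

Lemma moebius_proper : proper_metric (moebiusSpace Z).
Proof.
move=> mu r; rewrite compact_ultra => F FU Fr.
have [|nu Fnu] := @moebius_ultra_cvg (mdist (moebius_base Z) mu + r) F FU.
  apply: filterS Fr => nu /= mn; apply: le_trans (metric_triangle _ mu _) _.
  by rewrite lerD2l.
exists nu; split => //=; apply/ler_addgt0Pr => e e0.
have /metricType_numDomainType.fcvgrPdist_lt/(_ _ e0) Fe := Fnu.
have [nu' [mr ne]] := filter_ex (filterI Fr Fe).
apply: le_trans (metric_triangle _ nu' _) _; rewrite (metric_sym nu').
by apply: lerD => //; exact: ltW.
Qed.

End UniformLimits.

(** * The compactification of a Moebius space *)

Section Hat.
Context {R : realType} (Z : antipodalSpace R).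
Implicit Types (mu nu : moebiusSpace Z) (x y z : Z).
Local Notation rho := (@antipodal_fun R Z).

Let rhoK := antipodal_space_kernel Z.
Let Zc := @antipodal_compact R Z.
Let rhoA := antipodal_funP Z.
Let rhoS : separating rho. Proof. by case: rhoA. Qed.
Let rhoC x y : rho x y = rho y x. Proof. by case: rhoS. Qed.
Let rho_ge0 x y : 0 <= rho x y. Proof. by case: rhoS. Qed.
Let rho_le1 x y : rho x y <= 1.
Proof. by case: rhoK => _ /(_ x y)/andP[]. Qed.
Let ptight mu := potential_tight mu.

Inductive moebius_hat : Type :=
  | Inner of moebiusSpace Z
  | Ideal of Z.

Implicit Types p q : moebius_hat.

(** The uniform norm of the potential of [mu]. *)
Definition height mu : R := mdist (moebius_base Z) mu / 2.

Lemma height_bound mu x : `|potential mu x| <= height mu.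
Proof. by have /potential_bounded := lexx (mdist (moebius_base Z) mu); apply. Qed.

Lemma height_min mu : exists x, potential mu x = - height mu.
Proof.
have [x xE] := mdist_attained (moebius_base Z) mu; exists x.
by rewrite /height xE potential_base; lra.
Qed.

(** [shadow p z] extends [rho] to the points at finite distance: it is
    [exp (- (p | z))] for the Gromov product based at the base point. *)
Definition shadow p : Z -> R :=
  match p with
  | Inner mu => fun z => expR (potential mu z - height mu)
  | Ideal x => rho x
  end.

(** With these weights [shadow p x] is the supremum of [rho x y * weight p y] over
    [y], which for a point [x] of [Z] is attained by the indicator of that point. *)
Definition weight p : Z -> R :=
  match p with
  | Inner mu => fun z => expR (- potential mu z - height mu)
  | Ideal x => fun z => (z == x)%:R
  end.

Lemma weight01 p z : 0 <= weight p z <= 1.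
Proof.
case: p => [mu|x] /=; last by case: (z == x); rewrite ?lexx ler01.
rewrite expR_ge0/= -expR0 ler_expR; have := height_bound mu z.
by rewrite ler_norml => /andP[? ?]; lra.
Qed.

Let weight_ge0 p z : 0 <= weight p z. Proof. by case/andP: (weight01 p z). Qed.
Let weight_le1 p z : weight p z <= 1. Proof. by case/andP: (weight01 p z). Qed.

Lemma shadow_ge p x y : rho x y * weight p y <= shadow p x.
Proof.
case: p => [mu|z] /=; last first.
  have [->|_] := eqVneq y z; first by rewrite mulr1 rhoC.
  by rewrite mulr0.
apply: le_trans (ler_wpM2r (expR_ge0 _) (tight_feasible rhoK (ptight mu) x y)) _.
by rewrite -expRD ler_expR; lra.
Qed.

Lemma shadow_attained p x : exists y, shadow p x = rho x y * weight p y.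
Proof.
case: p => [mu|z] /=; last by exists z; rewrite eqxx mulr1 rhoC.
have [y xy] := tight_partner Zc rhoA x (ptight mu).
by exists y; rewrite xy -expRD; congr expR; lra.
Qed.

Lemma shadow01 p z : 0 <= shadow p z <= 1.
Proof.
have [y ->] := shadow_attained p z; rewrite mulr_ge0//=.
by rewrite -[leRHS]mulr1 ler_pM.
Qed.

Let shadow_ge0 p z : 0 <= shadow p z. Proof. by case/andP: (shadow01 p z). Qed.

(** A shadow vanishes somewhere exactly for the points of [Z], and its minimum
    [exp (- 2 * height mu)] recovers the height otherwise. *)
Lemma shadow_inj : injective shadow.
Proof.
have neq mu x : shadow (Inner mu) <> shadow (Ideal x).
  move=> /(congr1 (fun f => f x))/= /eqP.
  by rewrite (separating_xx rhoS) expR_eq0.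
have le mu nu : shadow (Inner mu) = shadow (Inner nu) -> height mu <= height nu.
  move=> e; have [x xE] := height_min mu.
  have /(congr1 (fun f => f x))/= /expR_inj := e; rewrite xE.
  by have := height_bound nu x; rewrite ler_norml => /andP[? ?]; lra.
case=> [mu|x] [nu|y] e.
- congr Inner; apply: potential_inj; apply/funext => x.
  have hE : height mu = height nu.
    by apply: le_anti; rewrite (le _ _ e) (le _ _ (esym e)).
  by have /(congr1 (fun f => f x))/= /expR_inj := e; rewrite hE; lra.
- by have := neq _ _ e.
- by have := neq _ _ (esym e).
- congr Ideal; have /(congr1 (fun f => f x))/= := e.
  rewrite (separating_xx rhoS) rhoC => /esym H.
  by have [_ _ _ /(_ x y)[-> //]] := rhoS.
Qed.

Let Zpt : Z.
Proof. by have [z _] := cid (fresh_point (@antipodal_four_points R Z) (s := [::]) isT). Qed.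

Definition shadow_family : supFamily R moebius_hat Z :=
  SupFamily shadow01 shadow_inj Zpt.

Local Notation hatM := (sup_space shadow_family).

Lemma mdist_hat_leP (c : R) (p q : hatM) :
  mdist p q <= c <-> forall z, `|shadow p z - shadow q z| <= c.
Proof. exact: mdist_sup_leP. Qed.

Lemma mdist_hat (p q : hatM) z : `|shadow p z - shadow q z| <= mdist p q.
Proof. exact: (mdist_hat_leP _ _ _).1. Qed.

(** The logarithm of a shadow is nonpositive, where [exp] is 1-Lipschitz. *)
Lemma Inner_lipschitz mu nu : mdist (Inner mu : hatM) (Inner nu) <= mdist mu nu.
Proof.
apply/mdist_hat_leP => z.
have main a b : shadow (Inner a) z <= shadow (Inner b) z + mdist a b.
  rewrite /=; set s := potential a z - height a; set t := potential b z - height b.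
  have st : s <= t + mdist a b.
    have tri : mdist (moebius_base Z) b <= mdist (moebius_base Z) a + mdist a b.
      exact: metric_triangle.
    have : `|potential a z - potential b z| <= mdist a b / 2.
      by have := mdist_potential a b z; lra.
    by rewrite ler_norml /s /t /height => /andP[_]; lra.
  have s0 : expR s <= 1 by have /andP[_] := shadow01 (Inner a) z.
  have := expR_ge1Dx (t - s); rewrite expRB ler_pdivlMr ?expR_gt0//.
  have := expR_ge0 s; have : 0 <= mdist a b by exact: mdist_ge0.
  move: s0; set u := expR s; move=> u1 d0 u0.
  have : (1 - mdist a b) * u <= (1 + (t - s)) * u by rewrite ler_wpM2r//; lra.
  have : mdist a b * u <= mdist a b by rewrite ler_piMr.
  lra.
have m1 := main mu nu; have := main nu mu; rewrite metric_sym => m2.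
move: m1 m2; move: (shadow _ z) (shadow _ z) (mdist mu nu) => u v w m1 m2.
by rewrite ler_norml; apply/andP; split; lra.
Qed.

(** Far from the base point, the weight of a potential concentrates near the points
    where the potential is minimal. *)
Lemma hat_near_ideal (e : R) : 0 < e -> exists T : R, forall mu x,
  T <= height mu -> potential mu x = - height mu ->
  mdist (Inner mu : hatM) (Ideal x) <= e.
Proof.
move=> e0; have [d d0 dP] := separating_modulus rhoS Zc e0.
pose m := Num.min e (d / 2); have m0 : 0 < m by rewrite lt_min e0 divr_gt0.
(* beyond this height all weights are below [m], except at points [d]-close to [x] *)
exists (- ln m) => mu x Tmu xE; apply/mdist_hat_leP => z.
have hm : expR (- height mu) <= m by rewrite -[leRHS]lnK// ler_expR; lra.
have me : m <= e by rewrite ge_min lexx.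
have md : m < d by rewrite gt_min; apply/orP; right; lra.
have lo : rho x z <= shadow (Inner mu) z.
  have := shadow_ge (Inner mu) z x; rewrite /= xE opprK subrr expR0 mulr1.
  by rewrite rhoC.
rewrite ger0_norm ?subr_ge0// lerBlDr.
have [y ->] := shadow_attained (Inner mu) z.
have [wm|wm] := leP (weight (Inner mu) y) m.
  have : rho z y * weight (Inner mu) y <= weight (Inner mu) y by rewrite ler_piMl.
  by have := rho_ge0 x z; rewrite [shadow (Ideal x) z]/=; lra.
have py : potential mu y <= 0.
  rewrite leNgt; apply/negP => p0; move: wm; rewrite ltNge => /negP; apply.
  by apply: le_trans hm; rewrite ler_expR; lra.
have yx : rho y x < d.
  apply: le_lt_trans md; apply: le_trans hm.
  apply: le_trans (tight_feasible rhoK (ptight mu) y x) _.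
  by rewrite xE ler_expR; lra.
have := dP _ _ z yx; rewrite ltr_distl (rhoC y z) => /andP[_ ?].
have : rho z y * weight (Inner mu) y <= rho z y by rewrite ler_piMr.
by rewrite [shadow (Ideal x) z]/=; lra.
Qed.

Lemma Ideal_near x (e : R) : 0 < e ->
  \forall y \near x, mdist (Ideal x : hatM) (Ideal y) <= e.
Proof.
move=> e0; have [d d0 dP] := separating_modulus rhoS Zc e0.
have := separating_near rhoS x d0; apply: filterS => y xy.
by apply/mdist_hat_leP => z; apply: ltW; exact: dP.
Qed.

(** Along an ultrafilter either the points lie in [Z], or the heights stay bounded and
    [moebius_ultra_cvg] applies, or they tend to infinity and the points where the
    potentials are minimal converge in [Z]. *)
Lemma hat_compact : compact [set: hatM].
Proof.
rewrite compact_ultra => F FU _.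
have cvgP (p : hatM) : (forall e : R, 0 < e -> \forall a \near F, mdist p a <= e) ->
    exists a : hatM, setT a /\ F --> a.
  move=> H; exists p; split => //; apply/metricType_numDomainType.fcvgrPdist_lt => e e0.
  have e2 : 0 < e / 2 by rewrite divr_gt0.
  by apply: filterS (H _ e2) => q pq; apply: le_lt_trans pq _; lra.
pose toZ (p : hatM) : Z := if p is Ideal x then x else Zpt.
pose toM (p : hatM) : moebiusSpace Z := if p is Inner mu then mu else moebius_base Z.
have [FZ|FM] := in_ultra_setVsetC [set p : hatM | exists x, p = Ideal x] FU.
  have [|x _ Fx] := ultra_cvg_compact (f := toZ) FU Zc; first exact: filterT.
  apply: (cvgP (Ideal x)) => e e0.
  have FN : F [set p | mdist (Ideal x : hatM) (Ideal (toZ p)) <= e].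
    exact: Fx _ (Ideal_near x e0).
  by apply: filterS2 FZ FN => p [y ->].
have {}FM : F [set p : hatM | exists mu, p = Inner mu].
  by apply: filterS FM => -[mu|x] H; [exists mu|case: H; exists x].
have [[r Fr]|nFr] := pselect (exists r, F [set p | mdist (moebius_base Z) (toM p) <= r]).
  have [|mu Fmu] := @moebius_ultra_cvg _ _ r _ (ultra_fmap toM FU); first exact: Fr.
  apply: (cvgP (Inner mu)) => e e0.
  have Fe : F [set p | mdist mu (toM p) < e].
    by have /metricType_numDomainType.fcvgrPdist_lt/(_ _ e0) := Fmu.
  apply: filterS2 FM Fe => _ [nu ->] /= ne.
  by apply: le_trans (Inner_lipschitz _ _) _; exact: ltW.
have /choice[a aP] := height_min.
have [|x _ Fx] := ultra_cvg_compact (f := a \o toM) FU Zc; first exact: filterT.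
apply: (cvgP (Ideal x)) => e e0; have e2 : 0 < e / 2 by rewrite divr_gt0.
have [T TP] := hat_near_ideal e2.
have FT : F [set p | T <= height (toM p)].
  have [le|lt] := in_ultra_setVsetC [set p | mdist (moebius_base Z) (toM p) <= 2 * T] FU.
    by case: nFr; exists (2 * T).
  apply: filterS lt => p /negP; rewrite -ltNge /= /height; lra.
have FN : F [set p | mdist (Ideal x : hatM) (Ideal (a (toM p))) <= e / 2].
  exact: Fx _ (Ideal_near x e2).
apply: filterS3 FM FT FN => _ [mu ->] /= Tmu xa.
apply: le_trans (metric_triangle _ (Ideal (a mu) : hatM) _) _.
rewrite (metric_sym (Ideal (a mu) : hatM)).
by have := TP mu (a mu) Tmu (aP mu); move: xa => /=; lra.
Qed.

End Hat.

(** * The Gromov product on the compactification *)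

Section NegLn.
Context {R : realType}.

Definition neg_lne (v : R) : \bar R := (- lne v%:E)%E.

(** At arguments at most [0], where [lne] is [-oo], this function is constant. *)
Lemma neg_lne_continuous : continuous neg_lne.
Proof.
move=> v; have [v0|v0] := ltP 0 v.
  rewrite /continuous_at /neg_lne lne_EFin//.
  apply: cvg_trans (_ : (- ln w)%:E @[w --> v] --> _); last first.
    by apply: cvg_EFin; [exact: nearW|apply: cvgN; exact: continuous_ln].
  apply: near_eq_cvg; near=> w; rewrite lne_EFin//.
  by near: w; apply: (cvgr_gt v) => //; exact: cvg_id.
rewrite /continuous_at {2}/neg_lne le0_lneNy ?lee_fin//=.
apply/cvgeyPge => A; near=> w; have wA : w <= expR (- A).
  near: w; apply: (cvgr_le v); first exact: cvg_id.
  exact: le_lt_trans v0 (expR_gt0 _).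
rewrite /neg_lne leeNr; have [w0|w0] := leP w 0.
  by rewrite le0_lneNy ?lee_fin// leNye.
by rewrite lne_EFin// -EFinN lee_fin -ler_expR lnK.
Unshelve. all: by end_near. Qed.

Lemma neg_lne_eqy (v : R) : 0 <= v -> neg_lne v = +oo%E <-> v = 0.
Proof.
rewrite le_eqVlt => /orP[/eqP<-|v0].
  by rewrite /neg_lne le0_lneNy.
by rewrite /neg_lne lne_EFin//; split => // vE; rewrite vE ltxx in v0.
Qed.

Lemma neg_lne_ge0 (v : R) : v <= 1 -> (0 <= neg_lne v)%E.
Proof. by move=> v1; rewrite /neg_lne leeNr oppe0 lne_le0 lee_fin. Qed.

Lemma neg_lneK (v : R) : 0 <= v -> expeR (- neg_lne v)%E = v%:E.
Proof. by move=> v0; rewrite /neg_lne oppeK; apply/eqP; rewrite lneK_eq lee_fin. Qed.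

Lemma neg_lne_expR (a : R) : neg_lne (expR a) = (- a)%:E.
Proof. by rewrite /neg_lne lne_EFin ?expR_gt0// expRK. Qed.

End NegLn.

Section HatProduct.
Context {R : realType} (Z : antipodalSpace R).
Implicit Types (mu nu : moebiusSpace Z) (x y z : Z) (p q : moebius_hat Z).
Local Notation rho := (@antipodal_fun R Z).
Local Notation hatM := (sup_space (shadow_family Z)).

Let Zc := @antipodal_compact R Z.
Let rhoA := antipodal_funP Z.
Let rhoS : separating rho. Proof. by case: rhoA. Qed.
Let rhoC x y : rho x y = rho y x. Proof. by case: rhoS. Qed.
Let ptight mu := potential_tight mu.
Let pcont mu : continuous (potential mu).
Proof. exact (tight_continuous Zc rhoA (ptight mu)). Qed.
Let weight_ge0 p z : 0 <= weight p z. Proof. by case/andP: (weight01 p z). Qed.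
Let weight_le1 p z : weight p z <= 1. Proof. by case/andP: (weight01 p z). Qed.
Let shadow_ge0 p z : 0 <= shadow p z. Proof. by case/andP: (shadow01 p z). Qed.

(** [exp (- (p | q))] for the Gromov product at the base point; see
    [hat_pair_Inner]. *)
Definition hat_pair p q : R := sup (range (fun z => shadow p z * weight q z)).

Let pair_max p q : exists z, forall w,
  shadow p w * weight q w <= shadow p z * weight q z.
Proof.
case: q => [mu|x]; last first.
  exists x => w; rewrite /= eqxx mulr1; have [->|_] := eqVneq w x.
    by rewrite mulr1.
  by rewrite mulr0.
have [z0 _] := fresh_point (@antipodal_four_points R Z) (s := [::]) isT.
have [||z _ zmax] := @compact_EVT_max _ _ (fun z => shadow p z * weight (Inner mu) z) _ _ Zc.
- by exists z0.
- apply: continuous_subspaceT => z; apply: cvgM.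
    case: p => [nu|y] /=; last first.
      by apply: separating_cvg => //; exact: cvg_cst.
    apply: continuous_cvg; first exact: continuous_expR.
    by apply: cvgB; [exact: pcont|exact: cvg_cst].
  apply: continuous_cvg; first exact: continuous_expR.
  by apply: cvgB; [apply: cvgN; exact: pcont|exact: cvg_cst].
by exists z => w; apply: zmax; rewrite inE.
Qed.

Lemma hat_pair_attained p q : exists z, hat_pair p q = shadow p z * weight q z.
Proof.
have [z zmax] := pair_max p q; exists z; apply/eqP; rewrite eq_le; apply/andP; split.
  apply: ge_sup; first by eexists; exists z.
  by move=> _ [w _ <-].
apply: ub_le_sup; last by exists z.
by exists (shadow p z * weight q z) => _ [w _ <-].
Qed.

Lemma hat_pair_ge p q z : shadow p z * weight q z <= hat_pair p q.
Proof.
have [w wmax] := pair_max p q; apply: ub_le_sup; last by exists z.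
by exists (shadow p w * weight q w) => _ [v _ <-].
Qed.

Lemma hat_pair_ge0 p q : 0 <= hat_pair p q.
Proof. by have [z ->] := hat_pair_attained p q; rewrite mulr_ge0. Qed.

(** Both sides are the supremum of [rho x y * weight p x * weight q y]. *)
Lemma hat_pairC p q : hat_pair p q = hat_pair q p.
Proof.
have main (a b : moebius_hat Z) : hat_pair a b <= hat_pair b a.
  have [z ->] := hat_pair_attained a b; have [y ->] := shadow_attained a z.
  rewrite mulrAC; apply: le_trans (hat_pair_ge b a y).
  by rewrite ler_wpM2r// rhoC shadow_ge.
by apply: le_anti; rewrite !main.
Qed.

Lemma hat_pair_lipschitz (p p' q q' : hatM) :
  `|hat_pair p q - hat_pair p' q'| <= mdist p p' + mdist q q'.
Proof.
have main (a a' b : hatM) : hat_pair a b <= hat_pair a' b + mdist a a'.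
  have [z ->] := hat_pair_attained a b.
  have := hat_pair_ge a' b z; have := mdist_hat a a' z.
  rewrite ler_norml => /andP[_]; rewrite lerBlDr => le.
  have := ler_wpM2r (weight_ge0 b z) le; rewrite mulrDl.
  have : mdist a a' * weight b z <= mdist a a' by rewrite ler_piMr// mdist_ge0.
  move: (hat_pair _ _) (mdist _ _) (mdist _ _ * _) (shadow _ _ * _) (shadow _ _ * _).
  by move=> *; lra.
have m1 := main p p' q; have := main p' p q; rewrite (metric_sym p') => m2.
have := main q q' p'; have := main q' q p'; rewrite (metric_sym q').
rewrite !(hat_pairC _ p'); move: m1 m2.
move: (hat_pair p q) (hat_pair p' q) (hat_pair p' q') (mdist p p') (mdist q q').
by move=> *; rewrite ler_norml; apply/andP; split; lra.
Qed.

Lemma hat_pair_cvg (T : Type) (F : set_system T) {FF : Filter F}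
    (f g : T -> hatM) (p q : hatM) :
  f @ F --> p -> g @ F --> q -> hat_pair (f t) (g t) @[t --> F] --> hat_pair p q.
Proof.
move=> /metricType_numDomainType.cvgrPdist_lt fp.
move=> /metricType_numDomainType.cvgrPdist_lt gq.
apply/cvgrPdist_lt => e e0; have e2 : 0 < e / 2 by rewrite divr_gt0.
apply: filterS2 (fp _ e2) (gq _ e2) => t ft gt.
by apply: le_lt_trans (hat_pair_lipschitz _ _ _ _) _; lra.
Qed.

Lemma hat_pair_Ideal p x : hat_pair p (Ideal x) = shadow p x.
Proof.
apply: le_anti; apply/andP; split.
  have [z ->] := hat_pair_attained p (Ideal x); rewrite /=.
  by have [->|_] := eqVneq z x; rewrite ?mulr1// mulr0.
by apply: le_trans (hat_pair_ge p (Ideal x) x); rewrite /= eqxx mulr1.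
Qed.

Lemma hat_pair_Inner mu nu : hat_pair (Inner mu) (Inner nu) =
  expR (mdist mu nu / 2 - height mu - height nu).
Proof.
have E z : shadow (Inner mu) z * weight (Inner nu) z =
    expR (potential mu z - potential nu z - height mu - height nu).
  by rewrite /= -expRD; congr expR; lra.
apply: le_anti; apply/andP; split.
  have [z ->] := hat_pair_attained (Inner mu) (Inner nu); rewrite E ler_expR.
  have H := mdist_potential mu nu z.
  by have := ler_norm (potential mu z - potential nu z); lra.
have [z zE] := mdist_attained mu nu.
apply: le_trans (hat_pair_ge (Inner mu) (Inner nu) z).
by rewrite E zE ler_expR; lra.
Qed.

Lemma hat_pair_Inner_gt0 p (b : moebiusSpace Z) : 0 < hat_pair p (Inner b).
Proof.
case: p => [mu|x]; first by rewrite hat_pair_Inner expR_gt0.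
by rewrite hat_pairC hat_pair_Ideal expR_gt0.
Qed.

(** [exp (- (p | q))] for the Gromov product based at [b]. *)
Definition hat_visual (b : moebiusSpace Z) p q : R :=
  hat_pair p q * hat_pair (Inner b) (Inner b) /
    (hat_pair p (Inner b) * hat_pair q (Inner b)).

Lemma hat_visual_ge0 b p q : 0 <= hat_visual b p q.
Proof. by rewrite divr_ge0// mulr_ge0// hat_pair_ge0. Qed.

(** If [z] realizes [hat_pair p q] and [y] is an antipode of [z] for [b], then the
    value at [z] bounds one factor of the denominator and the value at [y] the other. *)
Lemma hat_visual_le1 b p q : hat_visual b p q <= 1.
Proof.
have pb := hat_pair_Inner_gt0 p b; have qb := hat_pair_Inner_gt0 q b.
rewrite ler_pdivrMr ?mulr_gt0// mul1r.
have [z ->] := hat_pair_attained p q.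
have [y yE] := shadow_attained (Inner b) z.
have -> : hat_pair (Inner b) (Inner b) = shadow (Inner b) z * weight (Inner b) z.
  rewrite hat_pair_Inner mdistxx /= -expRD; congr expR; lra.
rewrite yE mulrCA -mulrA mulrC -mulrA.
have := hat_pair_ge p (Inner b) z; have := hat_pair_ge q (Inner b) y.
have := ler_wpM2r (weight_ge0 (Inner b) y) (shadow_ge q y z).
move=> /le_trans/[apply] H1 H2.
have := ler_pM _ _ H2 H1; rewrite !mulr_ge0//; last by case: rhoS.
move=> /(_ isT isT); apply: le_trans; rewrite (rhoC y z).
by rewrite le_eqVlt; apply/orP; left; apply/eqP; ring.
Qed.

Lemma hat_visual_continuous b :
  continuous (fun p : hatM * hatM => hat_visual b p.1 p.2).
Proof.
move=> [p q].
have c1 : fst @ nbhs (p, q) --> (p : hatM) by exact: cvg_fst.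
have c2 : snd @ nbhs (p, q) --> (q : hatM) by exact: cvg_snd.
have cb : (fun=> Inner b : hatM) @ nbhs (p, q) --> (Inner b : hatM) by exact: cvg_cst.
apply: cvgM.
  by apply: cvgM; [exact: hat_pair_cvg|exact: cvg_cst].
apply: cvgV; first by rewrite gt_eqF// mulr_gt0// hat_pair_Inner_gt0.
by apply: cvgM; exact: hat_pair_cvg.
Qed.

Lemma hat_pair_diag mu : hat_pair (Inner mu) (Inner mu) = expR (- (2 * height mu)).
Proof. by rewrite hat_pair_Inner mdistxx; congr expR; lra. Qed.

Lemma hat_visual_Inner b mu nu :
  hat_visual b (Inner mu) (Inner nu) = expR (- gromov_product b mu nu).
Proof.
have quot (A B C D a c d e : R) : A = expR a -> B = expR c -> C = expR d ->
    D = expR e -> A * B / (C * D) = expR (a + c - (d + e)).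
  by move=> -> -> -> ->; rewrite -!expRD -expRN -expRD.
have arith (d d1 d2 hm hn hb : R) : d / 2 - hm - hn + - (2 * hb) -
    (d1 / 2 - hm - hb + (d2 / 2 - hn - hb)) = - ((d1 + d2 - d) / 2) by lra.
apply: etrans (quot _ _ _ _ _ _ _ _ (hat_pair_Inner mu nu) (hat_pair_diag b)
  (hat_pair_Inner mu b) (hat_pair_Inner nu b)) _.
exact: congr1 (arith _ _ _ _ _ _).
Qed.

Lemma hat_visual_Ideal b x y : hat_visual b (Ideal x) (Ideal y) = b x y.
Proof.
rewrite /hat_visual hat_pair_Ideal !(hat_pairC (Ideal _)) !hat_pair_Ideal.
rewrite hat_pair_Inner mdistxx potentialE /= -expRD -expRN -mulrA -expRD.
by congr (_ * expR _); lra.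
Qed.

(** The distance to [mu] is a continuous function of [hat_pair], hence it extends to
    the compactification. *)
Lemma Inner_embedding (mu : moebiusSpace Z) (A : set (moebiusSpace Z)) :
  nbhs mu A -> exists2 V, nbhs (Inner mu : hatM) V & (@Inner R Z) @^-1` V `<=` A.
Proof.
move=> /(metricType_numDomainType.nbhs_mdistP mu A)[e /= e0 eA].
pose f (q : hatM) : R := 2 * ln (hat_pair (Inner mu) q)
  - ln (hat_pair (Inner mu) (Inner mu)) - ln (hat_pair q q).
have fE nu : f (Inner nu) = mdist mu nu.
  have arith (a c e' d h k : R) : a = d / 2 - h - k -> c = - (2 * h) ->
      e' = - (2 * k) -> 2 * a - c - e' = d by move=> -> -> ->; lra.
  have ln_pair (g : R) (a : R) : g = expR a -> ln g = a by move=> ->; rewrite expRK.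
  exact: arith (ln_pair _ _ (hat_pair_Inner mu nu)) (ln_pair _ _ (hat_pair_diag mu))
    (ln_pair _ _ (hat_pair_diag nu)).
have cf (m : hatM) : m = Inner mu -> f q @[q --> m] --> f m.
  move=> mE; have cc (g h : hatM -> hatM) : g @ m --> m -> h @ m --> m ->
      ln (hat_pair (g q) (h q)) @[q --> m] --> ln (hat_pair m m).
    move=> cg ch; have g0 := hat_pair_Inner_gt0 m mu; rewrite -mE in g0.
    exact: (continuous_cvg _ (continuous_ln g0) (hat_pair_cvg cg ch)).
  have ff : Filter (nbhs m) := nbhs_filter m.
  have cm := @cvg_cst _ m _ (nbhs m) ff; have ci : id @ m --> m by exact: cvg_id.
  have ck (a : R) := @cvg_cst _ a _ (nbhs m) ff.
  have h1 := cvgM (ck 2) (cc _ _ cm ci).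
  have h2 := cvgB (h1 ff) (ck (ln (hat_pair m m))).
  have h3 := cvgB (h2 ff) (cc _ _ ci ci).
  by rewrite /f -mE; exact: h3 ff.
exists [set q | f q < e].
  by apply: (cvgr_lt _ (cf _ erefl)); rewrite fE mdistxx.
by move=> nu; rewrite /= fE; exact: eA.
Qed.

Lemma Inner_continuous : continuous (@Inner R Z : moebiusSpace Z -> hatM).
Proof.
move=> mu A /(metricType_numDomainType.nbhs_mdistP _ A)[e /= e0 eA].
apply/(metricType_numDomainType.nbhs_mdistP mu); exists e => // nu /= le.
by apply: eA => /=; apply: le_lt_trans le; exact: Inner_lipschitz.
Qed.

(** At time [t] the ray from the base point towards [x] has height [t / 2], and its
    potential is least at [x]. *)
Lemma Inner_dense : dense (range (@Inner R Z) : set hatM).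
Proof.
move=> O [p Op] oO; case: p Op => [mu|x] Op; first by exists (Inner mu); split.
have : nbhs (Ideal x : hatM) O by exact: open_nbhs_nbhs.
move=> /(metricType_numDomainType.nbhs_mdistP _ O)[e /= e0 eO].
have e2 : 0 < e / 2 by rewrite divr_gt0.
have [T TP] := hat_near_ideal Z e2.
have [c [c0 cx cl]] := moebius_ray (moebius_base Z) x.
pose t := Num.max 0 (2 * T); have t0 : 0 <= t by rewrite le_max lexx.
have tT : T <= t / 2.
  have : 2 * T <= t by rewrite le_max lexx orbT.
  lra.
have px : potential (c t) x = - (t / 2) by rewrite cx// potential_base sub0r.
have ht : height (c t) = t / 2.
  apply: le_anti; apply/andP; split.
    have := cl _ _ (lexx 0) t0; rewrite c0 sub0r normrN ger0_norm// /height; lra.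
  have := height_bound (c t) x; rewrite px normrN ger0_norm//; lra.
exists (Inner (c t)); split; last by exists (c t).
apply: eO => /=; rewrite metric_sym.
apply: le_lt_trans (TP (c t) x _ _) _; rewrite ?ht//; lra.
Qed.

Definition moebius_ext (b : moebiusSpace Z) p q : \bar R := neg_lne (hat_visual b p q).

Lemma Ideal_not_Inner x : ~ range (@Inner R Z) (Ideal x).
Proof. by move=> [mu]. Qed.

Lemma not_Inner_Ideal p : ~ range (@Inner R Z) p -> exists x, p = Ideal x.
Proof. by case: p => [mu H|x _]; [case: H; exists mu|exists x]. Qed.

Definition ideal_point x : set_type (~` range (@Inner R Z)) :=
  exist _ (Ideal x) (mem_set (@Ideal_not_Inner x)).

Definition moebius_gp : gromovProductSpace R.
Proof.
refine (@GromovProductSpace R (moebiusSpace Z) hatM (@Inner R Z) moebius_ext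
  (@moebius_proper R Z) (@moebius_geodesic R Z)
  (@moebius_geodesically_complete R Z) _ _ _ _ _ _ _).
- split.
  + exact: hat_compact.
  + exact: metric_hausdorff.
  + by move=> mu nu [].
  + exact: embedding_open Inner_continuous Inner_embedding.
  + exact: Inner_dense.
- exact: (compact_metric_second_countable (Inner (moebius_base Z) : hatM) (@hat_compact R Z)).
- by move=> b p q; apply: neg_lne_ge0; exact: hat_visual_le1.
- move=> b p; apply: continuous_cvg; first exact: neg_lne_continuous.
  exact: hat_visual_continuous.
- by move=> b mu nu; rewrite /moebius_ext hat_visual_Inner neg_lne_expR opprK.
- move=> b p q /not_Inner_Ideal[x ->] /not_Inner_Ideal[y ->].
  rewrite /moebius_ext neg_lne_eqy ?hat_visual_ge0// hat_visual_Ideal.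
  have [[_ _ _ ->] _ _] := moebius_antipodal b.
  by split => [->//|[]].
- have [s us s4] := @antipodal_four_points R Z.
  exists (map ideal_point s); last by rewrite size_map.
  by rewrite map_inj_uniq// => x y /(congr1 set_val) [].
Defined.

Lemma visual_moebius_gp (b : moebius_gp) (x y : Z) :
  @visual R moebius_gp b (ideal_point x) (ideal_point y) = (b : moebiusSpace Z) x y.
Proof.
by rewrite /visual [gp_ext _ _ _]/= /moebius_ext neg_lneK ?hat_visual_ge0//= hat_visual_Ideal.
Qed.

End HatProduct.

(** * Visual functions of a Gromov product space *)

Section ExpNeg.
Context {R : realType}.

Definition exp_neg (a : \bar R) : R := fine (expeR (- a)%E).

Lemma exp_negE (r : R) : exp_neg r%:E = expR (- r).
Proof. by []. Qed.

Lemma exp_neg_continuous (a : \bar R) : (0 <= a)%E -> {for a, continuous exp_neg}.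
Proof.
move=> a0; apply/cvgrPdist_lt => e e0; case: a a0 => [r _|_|//].
  have c : expR (- s) @[s --> r] --> expR (- r).
    apply: continuous_cvg; first exact: continuous_expR.
    by apply: cvgN; exact: cvg_id.
  by move/cvgrPdist_lt: c => /(_ e e0).
exists (- ln e); split; first exact: num_real.
move=> [s|_|//]; last by rewrite /exp_neg/= subrr normr0.
rewrite lte_fin => es; rewrite /exp_neg/= sub0r normrN ger0_norm ?expR_ge0//.
by rewrite -[ltRHS]lnK// ltr_expR; lra.
Qed.

Lemma exp_neg01 (a : \bar R) : (0 <= a)%E -> 0 <= exp_neg a <= 1.
Proof.
case: a => [r|_|//]; last by rewrite /exp_neg/= lexx ler01.
rewrite lee_fin => r0; rewrite exp_negE expR_ge0/= -[leRHS]expR0 ler_expR; lra.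
Qed.

Lemma exp_neg_eq0 (a : \bar R) : (0 <= a)%E -> exp_neg a = 0 <-> a = +oo%E.
Proof.
case: a => [r|_|//]; last by rewrite /exp_neg.
rewrite exp_negE; split => // /eqP; by rewrite expR_eq0.
Qed.

End ExpNeg.

Section Boundary.
Context {R : realType} (X : gromovProductSpace R).
Local Notation hat := (gp_hat X).
Local Notation i := (@gp_iota R X).
Implicit Types (x y z : X) (p q : hat).

Let hat_compact : compact [set: hat].
Proof. by have [] := gp_compactification X. Qed.
Let hat_hausdorff : hausdorff_space hat.
Proof. by have [] := gp_compactification X. Qed.
Let i_open (A : set X) : open A <-> exists2 U, open U & i @^-1` U = A.
Proof. by have [_ _ _ h _] := gp_compactification X; exact: h. Qed.
Let i_dense : dense (range i).
Proof. by have [] := gp_compactification X. Qed.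

Let i_continuous : continuous i.
Proof. by apply/continuousP => U oU; apply/i_open; exists U. Qed.

Definition gp_visual x p q : R := exp_neg (gp_ext x p q).

Lemma gp_visual_cvg (T : Type) (F : set_system T) {FF : Filter F}
    (f g : T -> hat) x p q :
  f @ F --> p -> g @ F --> q -> gp_visual x (f t) (g t) @[t --> F] --> gp_visual x p q.
Proof.
move=> fp gq; apply: continuous_cvg; first exact: exp_neg_continuous (gp_ext_ge0 _ _ _).
apply: (@cvg_comp _ _ _ (fun t => (f t, g t)) (fun r => gp_ext x r.1 r.2) _ (nbhs (p, q))).
  exact: cvg_pair.
exact: (@gp_ext_continuous R X x (p, q)).
Qed.

(** Inequalities between continuous functions of two points of the compactification
    need only be checked on the dense subset [X]. *)
Lemma gp_dense_le (f g : hat * hat -> R) : continuous f -> continuous g ->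
  (forall y z, f (i y, i z) <= g (i y, i z)) -> forall p q, f (p, q) <= g (p, q).
Proof.
move=> cf cg fg p q; rewrite leNgt; apply/negP => lt.
have c : f pq - g pq @[pq --> (p, q)] --> f (p, q) - g (p, q).
  by apply: cvgB; [exact: cf|exact: cg].
have [|[A B] /= [Ap Bq] AB] := cvgr_gt _ c 0; first by rewrite subr_gt0.
have pt (C : set hat) (w : hat) : nbhs w C -> exists y, C (i y).
  rewrite nbhsE => -[C' [oC' C'w] C'C].
  have [|v [C'v [y _ yE]]] := i_dense _ oC'; first by exists w.
  by exists y; apply: C'C; rewrite yE.
have [y Ay] := pt _ _ Ap; have [z Bz] := pt _ _ Bq.
have := AB (i y, i z) (conj Ay Bz); have := fg y z.
by rewrite /= subr_gt0 leNgt => /negbTE ->.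
Qed.

Lemma gp_dense_eq (f g : hat * hat -> R) : continuous f -> continuous g ->
  (forall y z, f (i y, i z) = g (i y, i z)) -> forall p q, f (p, q) = g (p, q).
Proof.
move=> cf cg fg p q; apply: le_anti; apply/andP.
by split; apply: gp_dense_le => // y z; rewrite fg.
Qed.

Lemma gp_visual_iota x y z : gp_visual x (i y) (i z) = expR (- gromov_product x y z).
Proof. by rewrite /gp_visual gp_extE. Qed.

Lemma gp_visual01 x p q : 0 <= gp_visual x p q <= 1.
Proof. exact: exp_neg01 (gp_ext_ge0 _ _ _). Qed.

Let cfst : continuous (fst : hat * hat -> hat). Proof. by move=> ?; exact: cvg_fst. Qed.
Let csnd : continuous (snd : hat * hat -> hat). Proof. by move=> ?; exact: cvg_snd. Qed.

Lemma gp_visual_continuous x : continuous (fun r : hat * hat => gp_visual x r.1 r.2).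
Proof. by move=> r; apply: gp_visual_cvg; [exact: cfst|exact: csnd]. Qed.

Lemma gp_visualC x p q : gp_visual x p q = gp_visual x q p.
Proof.
apply: (@gp_dense_eq (fun r => gp_visual x r.1 r.2) (fun r => gp_visual x r.2 r.1)).
- exact: gp_visual_continuous.
- by move=> r; apply: gp_visual_cvg; [exact: csnd|exact: cfst].
- move=> y z /=; rewrite !gp_visual_iota /gromov_product (metric_sym y z).
  by rewrite [_ y x + _]addrC.
Qed.

(** Change of base point: on [X] this is an identity between distances. *)
Lemma gp_visual_change x y p q :
  gp_visual y p q * (gp_visual x p (i y) * gp_visual x q (i y)) =
  gp_visual x p q * expR (- mdist x y).
Proof.
apply: (@gp_dense_eq
  (fun r => gp_visual y r.1 r.2 * (gp_visual x r.1 (i y) * gp_visual x r.2 (i y)))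
  (fun r => gp_visual x r.1 r.2 * expR (- mdist x y))).
- move=> r; apply: cvgM; first exact: gp_visual_continuous.
  by apply: cvgM; apply: gp_visual_cvg; try exact: cvg_cst; [exact: cfst|exact: csnd].
- by move=> r; apply: cvgM; [exact: gp_visual_continuous|exact: cvg_cst].
move=> a b /=; rewrite !gp_visual_iota -!expRD; congr expR.
have arith (ax ay bx b_y ab yx : R) :
    - ((ay + b_y - ab) / 2) + (- ((ax + yx - ay) / 2) + - ((bx + yx - b_y) / 2)) =
    - ((ax + bx - ab) / 2) + - yx by lra.
by rewrite /gromov_product (metric_sym x y); exact: arith.
Qed.

Lemma gp_visual_ge x y p : expR (- mdist x y) <= gp_visual x p (i y).
Proof.
apply: (@gp_dense_le (fun=> expR (- mdist x y)) (fun r => gp_visual x r.1 (i y)) _ _ _ p p).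
- by move=> r; exact: cvg_cst.
- by move=> r; apply: gp_visual_cvg; [exact: cfst|exact: cvg_cst].
move=> a b /=; rewrite gp_visual_iota ler_expR lerN2 /gromov_product.
have := metric_triangle a y x; rewrite (metric_sym x y).
by move: (mdist _ _) (mdist _ _) (mdist _ _) => *; lra.
Qed.

(** A small compact ball around a point of [X] is closed in the compactification, so
    density forces a whole neighbourhood of the point to lie in [X]. *)
Lemma range_iota_open : open (range i).
Proof.
rewrite openE => _ [x _ <-].
have [U oU UE] : exists2 U, open U & i @^-1` U = (ball x 1)°.
  by apply/i_open; exact: open_interior.
have Ux : U (i x) by rewrite -[U _]/((i @^-1` U) x) UE; exact: nbhsx_ballx.
rewrite /interior nbhsE; exists U => // p Up; apply: contrapT => pX.
have cK : closed (i @` cball x 1).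
  apply: compact_closed => //; apply: continuous_compact; last exact: gp_proper.
  exact: continuous_subspaceT.
have [|q [[Uq Kq] [y _ yq]]] := i_dense _ (openI oU (closed_openC cK)).
  by exists p; split => // -[y _ yp]; apply: pX; exists y.
apply: Kq; exists y => //; rewrite /cball/=.
have : (i @^-1` U) y by rewrite /= yq.
by rewrite UE => /interior_subset; rewrite ballEmdist => /ltW.
Qed.

Lemma boundary_compact : compact [set: gp_boundary X].
Proof.
rewrite compact_ultra => F FU _.
have [|p _ Fp] := ultra_cvg_compact (f := set_val) FU hat_compact; first exact: filterT.
have pX : (~` range i) p.
  apply: (closed_cvg (~` range i) _ _ p Fp).
    by apply: open_closedC; exact: range_iota_open.
  by apply: nearW => q; exact: set_valP.
exists (exist _ p (mem_set pX)); split => // A /=.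
rewrite nbhsE => -[_ [[W oW <-] Wp] WA]; rewrite nbhs_filterE.
have FW : F (set_val @^-1` W) by exact: Fp W (open_nbhs_nbhs (conj oW Wp)).
by apply: filterS FW => q; exact: WA.
Qed.

Lemma far_from_boundary p x (r : R) : ~ range i p ->
  nbhs p [set q | forall y, q = i y -> r < mdist x y].
Proof.
move=> pX; have cK : closed (i @` cball x r).
  apply: compact_closed => //; apply: continuous_compact; last exact: gp_proper.
  exact: continuous_subspaceT.
apply: filterS (open_nbhs_nbhs (conj (closed_openC cK) _)).
  by move=> q qK y qE; rewrite ltNge; apply/negP => xy; apply: qK; exists y.
by move=> [y _ yp]; apply: pX; exists y.
Qed.

(** A limit point in [X] would keep the points at bounded distance. *)
Lemma ultra_to_boundary (T : Type) (F : set_system T) (c : T -> X) x :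
  UltraFilter F -> (forall r : R, \forall t \near F, r < mdist x (c t)) ->
  exists xi : gp_boundary X, i \o c @ F --> set_val xi.
Proof.
move=> FU far.
have [|p _ Fp] := ultra_cvg_compact (f := i \o c) FU hat_compact; first exact: filterT.
suff pX : (~` range i) p by exists (exist _ p (mem_set pX)).
move=> [w _ wp]; have [U oU UE] : exists2 U, open U & i @^-1` U = (ball w 1)°.
  by apply/i_open; exact: open_interior.
have Up : nbhs p U.
  apply: open_nbhs_nbhs; split => //.
  by rewrite -wp -[U _]/((i @^-1` U) w) UE; exact: nbhsx_ballx.
have FU' : F ((i \o c) @^-1` U) by exact: Fp _ Up.
have [t [Ut]] := filter_ex (filterI FU' (far (mdist x w + 1))).
apply/negP; rewrite -leNgt; apply: le_trans (metric_triangle _ w _) _.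
rewrite lerD2l; have : (i @^-1` U) (c t) by [].
by rewrite UE => /interior_subset; rewrite ballEmdist => /ltW.
Qed.

(** Geodesic segments exist and extend to lines. *)
Lemma gp_line x y : exists c : R -> X,
  [/\ c 0 = x, c (mdist x y) = y & forall s t, mdist (c s) (c t) = `|s - t|].
Proof.
have [c [c0 cL ciso]] := gp_geodesic x y.
have [c' [c'iso cc']] := gp_complete (mdist_ge0 x y) ciso.
exists c'; split.
- by rewrite -cc' ?c0// in_itv/= lexx mdist_ge0.
- by rewrite -cc' ?cL// in_itv/= lexx mdist_ge0.
- by move=> s t; exact: c'iso.
Qed.

(** The end of a geodesic ray from [x] through [y]. *)
Lemma gp_shoot x y : exists xi : gp_boundary X,
  gp_visual x (set_val xi) (i y) = expR (- mdist x y).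
Proof.
have [c [c0 cL ciso]] := gp_line x y.
have [F [FU subF]] := ultraFilterLemma (@proper_pinfty_nbhs R).
have [|xi xiP] := ultra_to_boundary (c := c) (x := x) FU.
  move=> r; apply: subF; near=> t; rewrite -c0 ciso sub0r normrN.
  by apply: lt_le_trans (ler_norm _); near: t; apply: nbhs_pinfty_gt; exact: num_real.
exists xi; have c1 : gp_visual x (i (c t)) (i y) @[t --> F] --> gp_visual x (set_val xi) (i y).
  by apply: gp_visual_cvg xiP _; exact: cvg_cst.
have c2 : gp_visual x (i (c t)) (i y) @[t --> F] --> expR (- mdist x y).
  apply: cvg_near_cst; apply: subF; near=> t.
  have tL : mdist x y <= t by near: t; apply: nbhs_pinfty_ge; exact: num_real.
  have L0 : 0 <= mdist x y by exact: mdist_ge0.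
  have t0 : 0 <= t := le_trans L0 tL.
  have E1 : mdist (c t) x = t by rewrite -{1}c0 ciso subr0 ger0_norm.
  have E2 : mdist (c t) y = t - mdist x y.
    by rewrite -{1}cL ciso ger0_norm// subr_ge0.
  rewrite gp_visual_iota /gromov_product E1 E2 (metric_sym y x).
  by congr (expR (- _)); move: (mdist x y) => L; lra.
exact: (norm_cvg_unique c1 c2).
Unshelve. all: by end_near. Qed.

Lemma boundary_filter p : exists F : set_system X, UltraFilter F /\ i @ F --> p.
Proof.
pose G : set_system X := filter_from (nbhs p) (fun V => i @^-1` V).
have GF : ProperFilter G.
  apply: filter_from_proper; last first.
    move=> V; rewrite nbhsE => -[U [oU Up] UV].
    have [|q [Uq [y _ yq]]] := i_dense _ oU; first by exists p.
    by exists y; apply: UV; rewrite yq.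
  apply: filter_from_filter; first by exists setT; exact: filterT.
  by move=> A B pA pB; exists (A `&` B) => //; exact: filterI.
have [F [FU GsubF]] := ultraFilterLemma GF; exists F; split => // V pV.
by apply: GsubF; exists V.
Qed.

(** A point [eta] opposite to [xi] seen from [x]: continue backwards through [x] the
    geodesics from [x] to points converging to [xi]. *)
Lemma gp_antipode x (xi : gp_boundary X) : exists eta : gp_boundary X,
  gp_visual x (set_val xi) (set_val eta) = 1.
Proof.
have [F [FU Fxi]] := boundary_filter (set_val xi).
have /choice[a aP] : forall y, exists z, mdist x z = mdist x y /\
    gromov_product x y z = 0.
  move=> y; have [c [c0 cL ciso]] := gp_line x y; exists (c (- mdist x y)).
  have L0 : 0 <= mdist x y by exact: mdist_ge0.
  have E1 : mdist x (c (- mdist x y)) = mdist x y.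
    by rewrite -{1}c0 ciso opprK add0r ger0_norm.
  have E2 : mdist y (c (- mdist x y)) = mdist x y + mdist x y.
    by rewrite -{1}cL ciso opprK ger0_norm// addr_ge0.
  split => //; rewrite /gromov_product (metric_sym (c _)) E1 E2 (metric_sym y).
  by move: (mdist x y) => L; lra.
have far (r : R) : \forall y \near F, r < mdist x y.
  have Ffar : F (i @^-1` [set q | forall y, q = i y -> r < mdist x y]).
    exact: Fxi _ (far_from_boundary x r (set_valP xi)).
  by apply: filterS Ffar => y; exact.
have [|eta etaP] := ultra_to_boundary (c := a) (x := x) FU.
  by move=> r; apply: filterS (far r) => y; have [-> _] := aP y.
exists eta; have c1 : gp_visual x (i y) (i (a y)) @[y --> F] -->
    gp_visual x (set_val xi) (set_val eta) by exact: gp_visual_cvg Fxi etaP.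
have c2 : gp_visual x (i y) (i (a y)) @[y --> F] --> (1 : R).
  apply: cvg_near_cst; apply: nearW => y.
  by rewrite gp_visual_iota; have [_ ->] := aP y; rewrite oppr0 expR0.
exact: (norm_cvg_unique c1 c2).
Qed.

Lemma visualE x (xi eta : gp_boundary X) :
  visual x xi eta = gp_visual x (set_val xi) (set_val eta).
Proof. by []. Qed.

Lemma boundary_continuous : continuous (set_val : gp_boundary X -> hat).
Proof. exact: initial_continuous. Qed.

Lemma visual_separating x : separating (@visual R X x).
Proof.
split.
- move=> r; apply: gp_visual_cvg.
    by apply: (continuous_comp (f := fst)); [exact: cvg_fst|exact: boundary_continuous].
  by apply: (continuous_comp (f := snd)); [exact: cvg_snd|exact: boundary_continuous].
- by move=> xi eta; rewrite !visualE gp_visualC.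
- by move=> xi eta; have /andP[] := gp_visual01 x (set_val xi) (set_val eta).
- move=> xi eta; rewrite visualE /gp_visual exp_neg_eq0 ?gp_ext_ge0//.
  rewrite (gp_ext_boundary x (set_valP xi) (set_valP eta)).
  by split => [|->//]; exact: val_inj.
Qed.

Lemma visual_antipodal x : antipodal (@visual R X x).
Proof.
have ex xi : exists eta, visual x xi eta = 1 by exact: gp_antipode.
split => //; first exact: visual_separating.
have [xi _] := fresh_point (@gp_four_points R X) (s := [::]) isT.
have [eta xieta] := ex xi.
have le1 (a b : gp_boundary X) : visual x a b <= 1.
  by have /andP[] := gp_visual01 x (set_val a) (set_val b).
apply/eqP; rewrite eq_le; apply/andP; split.
  by apply: ge_sup; [eexists; exists (xi, eta)|move=> _ [[a b] _ <-]; exact: le1].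
rewrite -{1}xieta; apply: ub_le_sup; last by exists (xi, eta).
by exists 1 => _ [[a b] _ <-]; exact: le1.
Qed.

End Boundary.

Section Metrizable.
Context {R : realType} (Z : topologicalType) (rho : Z -> Z -> R).
Hypotheses (Zc : compact [set: Z]) (rhoS : separating rho).

Lemma separating_nbhs x (A : set Z) : nbhs x A ->
  exists2 d : R, 0 < d & forall y, rho x y < d -> A y.
Proof.
rewrite nbhsE => -[U [oU Ux] UA].
have cK : compact (~` U) by apply: subclosed_compact Zc _ => //; exact: open_closedC.
have [U0|/set0P/negP] := pselect ((~` U) !=set0); last first.
  rewrite negbK => /eqP/(congr1 setC); rewrite setCK setC0 => UT.
  by exists 1 => // y _; apply: UA; rewrite UT.
have [|y Uy ymin] := @compact_EVT_min _ _ (rho x) _ U0 cK.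
  apply: continuous_subspaceT => y.
  by apply: separating_cvg => //; exact: cvg_cst.
exists (rho x y).
  have [_ _ ge0 /(_ x y) [xy _]] := rhoS; rewrite lt_neqAle ge0 andbT eq_sym.
  by apply/eqP => /xy yx; move: Uy; rewrite inE -yx.
move=> z xz; apply: UA; apply: contrapT => Uz.
by have := ymin z; rewrite inE => /(_ Uz); rewrite leNgt xz.
Qed.

(** The uniform distance between the functions [rho x] is a compatible metric. *)
Lemma separating_metrizable (z0 : Z) : (forall x y, rho x y <= 1) -> metrizable R Z.
Proof.
move=> le1; have [_ rC ge0 eq0] := rhoS.
have r01 x y : 0 <= rho x y <= 1 by rewrite ge0 le1.
have rI : injective rho.
  move=> x y /(congr1 (fun f => f y)); rewrite (separating_xx rhoS).
  by move=> /eq0.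
pose J := SupFamily r01 rI z0; exists (sup_space J), id, id; split => //.
- move=> x A /(metricType_numDomainType.nbhs_mdistP _ A)[e /= e0 eA].
  have e2 : 0 < e / 2 by rewrite divr_gt0.
  have [d d0 dP] := separating_modulus rhoS Zc e2.
  have := separating_near rhoS x d0; apply: filterS => y xy; apply: eA => /=.
  apply: (@le_lt_trans _ _ (e / 2)); last by lra.
  by apply/mdist_sup_leP => z; apply: ltW; exact: dP.
- move=> x A /separating_nbhs[d d0 dA].
  apply/(metricType_numDomainType.nbhs_mdistP (x : sup_space J)).
  exists d => // y /= xy; apply: dA; apply: le_lt_trans xy.
  have : `|J x y - J y y| <= mdist (x : sup_space J) (y : sup_space J).
    exact: (sup_dist_ge J x y y).
  by rewrite /= (separating_xx rhoS) subr0 ger0_norm.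
Qed.

End Metrizable.

Definition boundary_space (R : realType) (X : gromovProductSpace R) (x : X) :
  antipodalSpace R.
Proof.
refine (@AntipodalSpace R (gp_boundary X) (@visual R X x) (@boundary_compact R X) _
  (@gp_four_points R X) (visual_antipodal x)).
have [xi _] := cid (fresh_point (@gp_four_points R X) (s := [::]) isT).
apply: (separating_metrizable (boundary_compact (X := X)) (visual_separating x) xi).
by move=> a b; have /andP[] := gp_visual01 x (set_val a) (set_val b).
Defined.

(** * Maximal spaces are Moebius spaces *)

Lemma moebius_space_eq {R : realType} (Z : antipodalSpace R) (mu nu : moebiusSpace Z) :
  moebius_fun mu = moebius_fun nu -> mu = nu.
Proof.
move=> e; apply: mdist_positivity.
by rewrite moebius_mdistE e -moebius_mdistE mdistxx.
Qed.

Section VisualPoint.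
Context {R : realType} (X : gromovProductSpace R).
Local Notation i := (@gp_iota R X).
Implicit Types (x y z : X) (xi eta : gp_boundary X).

Let gp_visual_gt0 x y p : 0 < gp_visual x p (i y).
Proof. by apply: lt_le_trans (gp_visual_ge x y p); exact: expR_gt0. Qed.

Lemma visual_change x y xi eta :
  visual y xi eta = visual x xi eta * expR (- mdist x y) /
    (gp_visual x (set_val xi) (i y) * gp_visual x (set_val eta) (i y)).
Proof.
have n : gp_visual x (set_val xi) (i y) * gp_visual x (set_val eta) (i y) != 0.
  by rewrite mulf_neq0// gt_eqF// gp_visual_gt0.
by apply: (canRL (mulfK n)); exact: gp_visual_change.
Qed.

Lemma visual_moebius_equivalent x y : moebius_equivalent (visual x) (visual y).
Proof.
apply: (conformal_moebius_equivalent (visual_separating x)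
  (f := fun xi => expR (- (mdist x y / 2)) / gp_visual x (set_val xi) (i y))).
  by move=> xi; rewrite divr_gt0 ?expR_gt0// gp_visual_gt0.
move=> xi eta; rewrite (visual_change x).
have -> : expR (- mdist x y) = expR (- (mdist x y / 2)) * expR (- (mdist x y / 2)).
  by rewrite -expRD; congr expR; move: (mdist x y) => d; lra.
by field; rewrite !gt_eqF// gp_visual_gt0.
Qed.

(** The derivative is [exp (- d) / gp_visual y xi z ^+ 2], whose logarithm ranges
    between [- d] and [d], the value [d] being attained at the end of a geodesic ray
    from [y] through [z]. *)
Lemma moebius_dist_visual y z : moebius_dist (visual y) (visual z) = mdist y z.
Proof.
pose V xi := gp_visual y (set_val xi) (i z).
have V0 xi : 0 < V xi by exact: gp_visual_gt0.
pose D xi := expR (- mdist y z) / V xi ^+ 2.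
have DE : D = moebius_derivative (visual y) (visual z).
  apply/(moebius_derivativeP (@gp_four_points R X)).
  - exact: visual_separating.
  - exact: visual_separating.
  - exact: visual_moebius_equivalent.
  split.
  - move=> xi; have xiF : Filter (nbhs xi) := nbhs_filter xi.
    have cV : V eta @[eta --> xi] --> V xi.
      exact: (@gp_visual_cvg _ _ _ _ xiF _ _ _ _ _ (@boundary_continuous R X xi) (cvg_cst _)).
    have n : V xi * V xi != 0 by rewrite mulf_neq0// gt_eqF.
    have cVV : (V eta * V eta)^-1 @[eta --> xi] --> (V xi * V xi)^-1.
      by apply: cvgV n _; exact: cvgM.
    have ce : (fun=> expR (- mdist y z)) @ nbhs xi --> expR (- mdist y z).
      exact: cvg_cst.
    exact: cvgM ce cVV.
  - by move=> xi; rewrite divr_gt0 ?expR_gt0// exprn_gt0.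
  - move=> xi eta; rewrite (visual_change y) -/(V xi) -/(V eta) /D.
    by field; rewrite !gt_eqF.
have lnD xi : ln (D xi) = - mdist y z - 2 * ln (V xi).
  by rewrite /D ln_div ?posrE ?expR_gt0 ?exprn_gt0// expRK lnXn// mulr_natl.
have lnV xi : - mdist y z <= ln (V xi) <= 0.
  have /andP[_ V1] := gp_visual01 y (set_val xi) (i z).
  rewrite ln_le0 ?andbT// -ler_expR lnK ?posrE//; exact: gp_visual_ge.
have Dd xi : `|ln (D xi)| <= mdist y z.
  rewrite lnD; have := lnV xi; move: (mdist y z) (ln (V xi)) => d v /andP[? ?].
  by rewrite ler_norml; apply/andP; split; lra.
have [eta etaE] := gp_shoot y z.
rewrite /moebius_dist -DE; apply: le_anti; apply/andP; split.
  by apply: ge_sup; [eexists; exists eta|move=> _ [xi _ <-]].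
have -> : mdist y z = `|ln (D eta)|.
  rewrite lnD /V etaE expRK; have := mdist_ge0 y z; move: (mdist y z) => d d0.
  by rewrite (_ : _ - _ = d) ?ger0_norm//; lra.
apply: ub_le_sup; last by exists eta.
by exists (mdist y z) => _ [xi _ <-].
Qed.

Definition visual_point x y : moebiusSpace (boundary_space x) :=
  @MoebiusSpace R (boundary_space x) (@visual R X y) (visual_antipodal y)
    (visual_moebius_equivalent x y).

Lemma visual_point_isometric x y z :
  mdist (visual_point x y) (visual_point x z) = mdist y z.
Proof. exact: moebius_dist_visual. Qed.

Lemma visual_point_base x : visual_point x x = moebius_base (boundary_space x).
Proof. exact: moebius_space_eq. Qed.

(** Maximality is applied to the Moebius space of the boundary of [X], which is itself
    a Gromov product space with the same boundary: the extension of the identification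
    of the boundaries preserves visual functions, hence is a section of
    [visual_point]. *)
Lemma visual_point_surj x : maximal_gromov_product_space X ->
  forall mu, exists y, visual_point x y = mu.
Proof.
move=> Xmax; pose B := boundary_space x; pose Y := moebius_gp B.
pose i_ (xi : B) : gp_boundary Y := ideal_point xi.
have [xi0 _] := fresh_point (@gp_four_points R X) (s := [::]) isT.
(* every boundary point of [Y] is ideal: the value [xi0] is never taken *)
pose g (p : gp_boundary Y) : gp_boundary X :=
  if (set_val p : moebius_hat B) is Ideal xi then xi else xi0.
have ig : cancel g i_.
  move=> p; have [xi pE] := not_Inner_Ideal (set_valP p).
  have gE : g p = xi by rewrite /g (pE : set_val p = Ideal xi).
  by apply: val_inj; rewrite gE; exact: esym pE.
have gi : cancel i_ g by [].
pose idl (xi : B) : sup_space (shadow_family B) := Ideal xi.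
have gH : homeomorphism g.
  exists i_; split => //.
  - move=> p A gA; have pE := ig p; move: (g p) pE gA => xi <- {p} gA.
    have [d d0 dA] := separating_nbhs (boundary_compact (X := X)) (visual_separating x) gA.
    have nd : nbhs (idl xi) [set q | mdist (idl xi) q < d].
      by apply/(metricType_numDomainType.nbhs_mdistP (idl xi)); exists d.
    have nb : nbhs (i_ xi) [set p : gp_boundary Y | mdist (idl xi) (set_val p) < d].
      exact: (@boundary_continuous R Y (i_ xi) _ nd).
    apply: (@filterS _ _ (nbhs_filter (i_ xi)) _ _ _ nb) => p /= pd.
    have pE := ig p; move: (g p) pE pd => eta <- {p} /= pd.
    apply: dA; apply: le_lt_trans pd.
    have := mdist_hat (idl xi) (idl eta) eta.
    rewrite /= (separating_xx (visual_separating x)) subr0; apply: le_trans.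
    exact: ler_norm.
  - move=> xi A; rewrite nbhsE => -[_ [[W oW <-] Wxi] WA].
    have WI : nbhs (idl xi) W.
      exact: open_nbhs_nbhs (conj oW Wxi).
    have [d /= d0 dW] := iffLR (metricType_numDomainType.nbhs_mdistP _ _) WI.
    have d2 : 0 < d / 2 by rewrite divr_gt0.
    have := Ideal_near (Z := B) xi d2; apply: filterS => eta xieta.
    by apply: WA; apply: dW => /=; lra.
have gM : moebius_homeomorphism (@visual R Y (moebius_base B)) (@visual R X x) g.
  split => // a b c d _.
  have E u v : visual x (g u) (g v) = @visual R Y (moebius_base B) u v.
    by rewrite -{2}(ig u) -{2}(ig v) visual_moebius_gp.
  by rewrite /cross_ratio !E.
have [f [h [fiso hc hf hg]]] := Xmax Y (moebius_base B) x g gM.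
move=> mu; exists (f mu); apply: moebius_space_eq; apply/funext => xi; apply/funext => eta.
have E : forall p q : gp_hat Y, gp_visual (f mu) (h p) (h q) = @gp_visual R Y mu p q.
  apply: (@gp_dense_eq R Y (fun r => gp_visual (f mu) (h r.1) (h r.2))
    (fun r => @gp_visual R Y mu r.1 r.2)).
  - move=> r; apply: gp_visual_cvg.
      by apply: (continuous_comp (f := fst)); [exact: cvg_fst|exact: hc].
    by apply: (continuous_comp (f := snd)); [exact: cvg_snd|exact: hc].
  - exact: gp_visual_continuous.
  - move=> a b /=; rewrite !hf !gp_visual_iota /gromov_product.
    by rewrite !fiso.
transitivity (gp_visual (f mu) (h (set_val (i_ xi))) (h (set_val (i_ eta)))).
  by rewrite !hg.
by rewrite E -visualE visual_moebius_gp.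
Qed.

End VisualPoint.

(** Pointed Gromov-Hausdorff convergence is invariant under pointed isometries. *)
Lemma pGH_converges_isometric {R : realType} (X_ Y_ : nat -> metricType R)
    (p_ : forall n, X_ n) (q_ : forall n, Y_ n) (X Y : metricType R) (p : X) (q : Y)
    (t_ : forall n, X_ n -> Y_ n) (t : X -> Y) :
  (forall n x y, mdist (t_ n x) (t_ n y) = mdist x y) ->
  (forall n, t_ n (p_ n) = q_ n) -> (forall n y, exists x, t_ n x = y) ->
  (forall x y, mdist (t x) (t y) = mdist x y) ->
  t p = q -> (forall y, exists x, t x = y) ->
  pGH_converges q_ q -> pGH_converges p_ p.
Proof.
move=> t_iso t_p t_surj tiso tp tsurj cv r e r0 e0.
have [s sK] := choice tsurj.
have siso a b : mdist (s a) (s b) = mdist a b by rewrite -tiso !sK.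
have sq : s q = p by apply: mdist_positivity; rewrite -tiso sK tp mdistxx.
have [n0 n0P] := cv r e r0 e0; exists n0 => n /n0P[f [[fB fd fC] fq]].
have tB x : cball (p_ n) r x -> cball (q_ n) r (t_ n x).
  by rewrite /cball/= -t_p t_iso.
exists (fun x => s (f (t_ n x))); split; last by rewrite t_p fq.
split.
- by move=> x /tB /fB; rewrite /cball/= -sq siso.
- apply: le_lt_trans fd; apply: ge_ereal_sup => _ [[x y] [/tB xB /tB yB] <-] /=.
  by apply: ereal_sup_ubound; exists (t_ n x, t_ n y) => //=; rewrite siso t_iso.
- move=> x xB; have [|y yB xy] := fC (t x).
    by rewrite /cball/= -tp tiso.
  have [z zy] := t_surj n y; exists z; first by move: yB; rewrite /cball/= -zy -t_p t_iso.
  by rewrite /cball/= zy -tiso sK.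
Qed.

Theorem theorem1p1 (R : realType) :
  (forall (Z_ : nat -> antipodalSpace R) (Z : antipodalSpace R),
     AI_converges (fun n : nat => @antipodal_fun R (Z_ n)) (@antipodal_fun R Z) ->
     pGH_converges (fun n : nat => moebius_base (Z_ n)) (moebius_base Z)) /\
  (forall (X_ : nat -> gromovProductSpace R) (x_ : forall n : nat, X_ n)
     (X : gromovProductSpace R) (x : X),
     (forall n : nat, maximal_gromov_product_space (X_ n)) ->
     maximal_gromov_product_space X ->
     AI_converges (fun n : nat => visual (x_ n)) (visual x) ->
     pGH_converges x_ x).
Proof.
split=> [Z_ Z|X_ x_ X x X_max Xmax cv]; first exact: moebius_pGH_converges.
apply: (pGH_converges_isometric (t_ := fun n => visual_point (x_ n))
  (t := visual_point x)).
- by move=> n y z; exact: visual_point_isometric.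
- by move=> n; exact: visual_point_base.
- by move=> n; exact: visual_point_surj.
- by move=> y z; exact: visual_point_isometric.
- exact: visual_point_base.
- exact: visual_point_surj.
by apply: (moebius_pGH_converges (Z_ := fun n => boundary_space (x_ n))
  (Z := boundary_space x)).
Qed.
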